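(* Let $1\le m\le d<\infty$ be integers. There exists a subset $\mathcal{M}\subseteq \mathcal{C}^2(\mathbb{R}^d,\mathbb{R}^m)$, which is the intersection of countably many open dense subsets of $\mathcal{C}^2(\mathbb{R}^d,\mathbb{R}^m)$, such that for every $f\in\mathcal{M}$ one has $$\mathcal{H}^{d-1}\left(\Sigma_f\cap K\right)<+\infty\qquad\text{for every compact } K\subset\mathbb{R}^d .$$
   Context: $\mathcal{C}^2(\mathbb{R}^d,\mathbb{R}^m)$ is the space of twice continuously differentiable maps $\mathbb{R}^d\to\mathbb{R}^m$, with the topology generated by the sets $\{g:\|g-f\|_{\mathcal{C}^2}<\varepsilon\}$ for $f\in\mathcal{C}^2(\mathbb{R}^d,\mathbb{R}^m)$ and $\varepsilon>0$. Here $\|h\|_{\mathcal{C}^2}\in[0,+\infty]$ is the supremum over $\mathbb{R}^d$ of the norms of $h$ and of its derivatives up to order $2$. For $f\in\mathcal{C}^2(\mathbb{R}^d,\mathbb{R}^m)$ with Jacobian matrix $Df(x)\in\mathbb{R}^{m\times d}$, the critical set is $\Sigma_f=\{x\in\mathbb{R}^d:\operatorname{rank}(Df(x))\le m-1\}$. $\mathcal{H}^{d-1}$ denotes the $(d-1)$-dimensional Hausdorff measure on $\mathbb{R}^d$. *)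

(* Defs.v *)
From HB Require Import structures.
From mathcomp Require Import all_boot all_order all_algebra.
From mathcomp Require Import all_classical all_reals all_analysis.

Set Implicit Arguments.
Unset Strict Implicit.
Unset Printing Implicit Defensive.

Import Order.TTheory GRing.Theory Num.Theory.
Import numFieldNormedType.Exports.

Local Open Scope classical_set_scope.
Local Open Scope ring_scope.

(* Points of R^d are row vectors.  The library's norm on matrices is the
   maximum of the entries, so the Euclidean norm (the Frobenius norm for
   matrices) is defined here. *)
Definition enorm (R : realType) (p q : nat) (A : 'M[R]_(p, q)) : R :=
  Num.sqrt (\sum_(i < p) \sum_(j < q) A i j ^+ 2).

(* The library's ['J f x] acts on row vectors by right multiplication, hence
   the transpose. *)
Definition Df (R : realType) (d m : nat) (f : 'rV[R]_d -> 'rV[R]_m)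
  (x : 'rV[R]_d) : 'M[R]_(m, d) := ('J f x)^T.

(* Df with its entries listed in a row: it can be differentiated again, and
   the entries of its Jacobian matrix are the second partial derivatives. *)
Definition Dfvec (R : realType) (d m : nat) (f : 'rV[R]_d -> 'rV[R]_m)
  (x : 'rV[R]_d) : 'rV[R]_(m * d) := mxvec (Df f x).

Definition D2f (R : realType) (d m : nat) (f : 'rV[R]_d -> 'rV[R]_m) :
  'rV[R]_d -> 'M[R]_(m * d, d) := Df (Dfvec f).

Definition is_C1 (R : realType) (d m : nat) (f : 'rV[R]_d -> 'rV[R]_m) : Prop :=
  (forall x, differentiable f x) /\ continuous (Df f).

Definition is_C2 (R : realType) (d m : nat) (f : 'rV[R]_d -> 'rV[R]_m) : Prop :=
  is_C1 f /\ is_C1 (Dfvec f).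

Record C2 (R : realType) (d m : nat) := MkC2 {
  C2_fun :> 'rV[R]_d -> 'rV[R]_m ;
  C2_funP : is_C2 C2_fun }.

Definition C2norm (R : realType) (d m : nat) (h : 'rV[R]_d -> 'rV[R]_m) :
  \bar R :=
  ereal_sup [set (Num.max (enorm (h x))
                 (Num.max (enorm (Df h x)) (enorm (D2f h x))))%:E | x in setT].

Lemma Df_cst (R : realType) (d m : nat) (a : 'rV[R]_m) :
  Df (cst a : 'rV[R]_d -> 'rV[R]_m) = cst 0.
Proof.
apply/funext => x; apply/matrixP => i j.
by rewrite /Df /jacobian diff_cst !mxE.
Qed.

Lemma is_C1_cst (R : realType) (d m : nat) (a : 'rV[R]_m) :
  is_C1 (cst a : 'rV[R]_d -> 'rV[R]_m).
Proof.
split=> [x|]; first exact: differentiable_cst.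
by rewrite Df_cst; apply: cst_continuous.
Qed.

Lemma is_C2_cst0 (R : realType) (d m : nat) :
  is_C2 (cst 0 : 'rV[R]_d -> 'rV[R]_m).
Proof.
split; first exact: is_C1_cst.
have -> : Dfvec (cst 0 : 'rV[R]_d -> 'rV[R]_m) = cst (mxvec 0).
  by apply/funext => x; rewrite /Dfvec Df_cst.
exact: is_C1_cst.
Qed.

HB.instance Definition _ (R : realType) (d m : nat) := gen_eqMixin (C2 R d m).
HB.instance Definition _ (R : realType) (d m : nat) := gen_choiceMixin (C2 R d m).
HB.instance Definition _ (R : realType) (d m : nat) :=
  isPointed.Build (C2 R d m) (MkC2 (@is_C2_cst0 R d m)).

Definition C2ball (R : realType) (d m : nat) (fe : C2 R d m * R) :
  set (C2 R d m) := [set g : C2 R d m | (C2norm (g \- fe.1)%R < fe.2%:E)%E].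

(* The topology generated by the balls {g : |g - f|_C2 < e}, e > 0.  Maps at
   infinite C2-distance from each other are allowed. *)
HB.instance Definition _ (R : realType) (d m : nat) :=
  isSubBaseTopological.Build (C2 R d m)
    [set fe : C2 R d m * R | 0 < fe.2] (@C2ball R d m).

Definition critical_set (R : realType) (d m : nat) (f : 'rV[R]_d -> 'rV[R]_m) :
  set 'rV[R]_d := [set x | (\rank (Df f x) <= m.-1)%N].

(* This is -oo for the empty set. *)
Definition ediam (R : realType) (d : nat) (A : set 'rV[R]_d) : \bar R :=
  ereal_sup [set (enorm (xy.1 - xy.2))%:E | xy in A `*` A].

(* (diam A)^s with the conventions of the Hausdorff measure: the empty set
   contributes 0 and, when s = 0, every nonempty set contributes 1 (also a
   singleton, as 0 ^+ 0 = 1), so that H^0 is the counting measure. *)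
Definition diam_pow (R : realType) (d s : nat) (A : set 'rV[R]_d) : \bar R :=
  if `[< A !=set0 >] then (ediam A ^+ s)%E else 0%E.

Definition hausdorff_delta (R : realType) (d s : nat) (delta : R)
  (A : set 'rV[R]_d) : \bar R :=
  ereal_inf [set (\sum_(0 <= k <oo) diam_pow s (U k))%E |
    U in [set U : nat -> set 'rV[R]_d |
      A `<=` \bigcup_k U k /\ forall k, (ediam (U k) <= delta%:E)%E]].

(* Without the normalizing constant (the volume of the s-dimensional ball of
   diameter 1) used by some authors. *)
Definition hausdorff (R : realType) (d s : nat) (A : set 'rV[R]_d) : \bar R :=
  ereal_sup [set hausdorff_delta s delta A | delta in [set delta : R | 0 < delta]].

(* Main.v *)
(* The critical set of f is the projection of the set Z of pairs (x, w), with w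
   in the left kernel of Df(x).  Normalising one entry of w to 1 leaves d
   equations in d + m - 1 unknowns; where they are transversal, Z is locally a
   Lipschitz graph over m - 1 of the variables, so that the (m - 1)-dimensional
   measure of its projection is locally finite, and m - 1 <= d - 1.
   Transversality on a ball, quantified by a constant c > 0, is an open
   condition.  It is dense: averaging f along the coordinate axes and cutting
   off makes the second derivatives Lipschitz on the ball, and then the
   parameters of a quadratic perturbation for which transversality fails at
   some (x, w) with cokernel vector v form the image of a Lipschitz map of
   d + (m - 1) + (d - 1) variables into a space of 2 d + m - 1 parameters.
   Such an image contains no ball. *)
From HB Require Import structures.
Require Import Defs.
From mathcomp Require Import finmap all_boot all_order all_algebra.
From mathcomp Require Import all_classical all_reals all_analysis.
From mathcomp Require Import borel_hierarchy.
From mathcomp Require Import ring lra zify.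
Set Implicit Arguments.
Unset Strict Implicit.
Unset Printing Implicit Defensive.
Import Order.TTheory GRing.Theory Num.Theory.
Import numFieldNormedType.Exports.
Local Open Scope classical_set_scope.
Local Open Scope ring_scope.

(** * Calculus of functions with continuous gradient *)

(** The obstacle is the low regularity. The map [w *m Df f x] is only of class C^1 and has [m - 1]
    more variables than values, so a Sard type transversality theorem would ask for class C^m.
    Counting replaces it, but a continuous image of a space of lower dimension can fill a ball;
    hence the second derivatives are first made Lipschitz.

    The count runs as follows. With [w j = 1], row [j] of [Df v = 0] follows from the other rows by
    pairing with [w], because [w *m Df = 0]. There remain [d + (m - 1) + d] equations for the triple
    [(x, w, v)], which has one unknown fewer. The quadratic family has exactly one parameter for
    each equation, so the equations can be solved explicitly for the parameters.

    All conditions are quantitative. The pigeonhole principle yields parameters at a positive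
    distance from the bad ones, not merely outside them, and this distance becomes the constant [c].
    For the zero set no graph is constructed: a Lipschitz bound in terms of [m - 1] coordinates is
    all that a count of covering sets needs. *)

Section RowNorm.
Variable R : realType.

Lemma rV_norm_le n (x : 'rV[R]_n) (e : R) : 0 <= e ->
  (`|x| <= e) <-> (forall a, `|x 0 a| <= e).
Proof.
move=> e0; have -> : `|x| = mx_norm x by [].
rewrite mx_normrE; split.
  by move/bigmax_leP => [_ h] a; exact: (h (0, a)).
by move=> h; apply/bigmax_leP; split => // -[i a] _; rewrite ord1; exact: h.
Qed.

Lemma rV_norm_coord n (x : 'rV[R]_n) a : `|x 0 a| <= `|x|.
Proof. by apply: (rV_norm_le x (normr_ge0 _)).1. Qed.

Lemma ler_norm_sum_cst (I : finType) (P : pred I) (F : I -> R) (e : R) :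
  0 <= e -> (forall i, P i -> `|F i| <= e) ->
  `|\sum_(i | P i) F i| <= #|I|%:R * e.
Proof.
move=> e0 h; apply: (le_trans (ler_norm_sum _ _ _)).
apply: (@le_trans _ _ (\sum_(i | P i) e)); first exact: ler_sum.
rewrite sumr_const -[_ *+ _]mulr_natl ler_wpM2r// ler_nat.
exact: max_card.
Qed.

End RowNorm.

Section Gradient.
Variables (R : realType) (d : nat).
Implicit Types (u v : 'rV[R]_d -> R) (g h : 'I_d -> 'rV[R]_d -> R).

(** The gradient is carried as data, one function per coordinate, so that the rules below compute
    derivatives as explicit formulas without Jacobian matrices. *)
Definition is_grad u g : Prop :=
  (forall x, is_diff x u (fun y : 'rV[R]_d => \sum_a y 0 a * g a x)) /\
  (forall a, continuous (g a)).

Lemma is_grad_continuous u g : is_grad u g -> continuous u.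
Proof. by move=> [h _] x; apply: differentiable_continuous; have [] := h x. Qed.

Lemma is_gradD u v g h : is_grad u g -> is_grad v h ->
  is_grad (u \+ v) (fun a => g a \+ h a).
Proof.
move=> [ug gc] [vh hc]; split=> [x|a x].
  apply: (@is_diff_eq _ _ _ _ _ _ _ (is_diffD (ug x) (vh x))).
  by apply/funext => y; rewrite fctE -big_split; apply: eq_bigr => a _; rewrite /= mulrDr.
exact: (continuousD (gc a x) (hc a x)).
Qed.

Lemma is_grad_cst (c : R) : is_grad (cst c) (fun _ => cst 0).
Proof.
split=> [x|a]; last exact: cst_continuous.
apply: (@is_diff_eq _ _ _ _ _ _ _ (is_diff_cst _ _)).
by apply/funext => y; rewrite big1// => a _; rewrite mulr0.
Qed.

Lemma is_gradM u v g h : is_grad u g -> is_grad v h ->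
  is_grad (u \* v) (fun a => (u \* h a) \+ (v \* g a)).
Proof.
move=> ugH vhH; have uc := is_grad_continuous ugH.
have vc := is_grad_continuous vhH; move: ugH vhH => [ug gc] [vh hc]; split=> [x|a x].
  apply: (@is_diff_eq _ _ _ _ _ _ _ (is_diffM (ug x) (vh x))).
  apply/funext => y /=; rewrite !fctE /GRing.scale/= !mulr_sumr -big_split.
  by apply: eq_bigr => a _ /=; ring.
exact: (continuousD (continuousM (uc x) (hc a x)) (continuousM (vc x) (gc a x))).
Qed.

Lemma is_gradZ (c : R) u g : is_grad u g ->
  is_grad (fun x => c * u x) (fun a x => c * g a x).
Proof.
move=> ug; have := is_gradM (is_grad_cst c) ug.
congr (is_grad _ _); apply/funext => a; apply/funext => x /=.
by rewrite mulr0 addr0.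
Qed.

Lemma is_gradB u v g h : is_grad u g -> is_grad v h ->
  is_grad (fun x => u x - v x) (fun a x => g a x - h a x).
Proof.
move=> ug vh; have := is_gradD ug (is_gradZ (-1) vh).
congr (is_grad _ _); first by apply/funext => x /=; rewrite mulN1r.
by apply/funext => a; apply/funext => x /=; rewrite mulN1r.
Qed.

Lemma is_grad_coord a : is_grad (fun x => x 0 a) (fun b => cst (b == a)%:R).
Proof.
split=> [x|b]; last exact: cst_continuous.
have lc : continuous (fun x : 'rV[R]_d => x 0 a) by exact: coord_continuous.
have lf : linear (fun x : 'rV[R]_d => x 0 a : R).
  by move=> c y z; rewrite !mxE.
have fd : differentiable (fun x : 'rV[R]_d => x 0 a) x by exact: differentiable_coord.
split => //.
pose lm := GRing.isLinear.Build R 'rV[R]_d R *:%R _ lf.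
pose L : {linear 'rV[R]_d -> R} := HB.pack (fun x : 'rV[R]_d => x 0 a) lm.
have -> : 'd (fun x : 'rV[R]_d => x 0 a) x = L :> (_ -> _) by exact: (@diff_lin _ _ _ L x lc).
apply/funext => y /=; rewrite (bigD1 a)//= eqxx mulr1 big1 ?addr0// => b ba.
by rewrite (negbTE ba) mulr0.
Qed.

Lemma is_grad_sum (I : Type) (r : seq I) (U : I -> 'rV[R]_d -> R) G :
  (forall i, is_grad (U i) (G i)) ->
  is_grad (fun x => \sum_(i <- r) U i x) (fun a x => \sum_(i <- r) G i a x).
Proof.
move=> UG; elim: r => [|i r IH].
  rewrite (_ : (fun x => _) = cst 0); last by apply/funext => x; rewrite big_nil.
  rewrite (_ : (fun a => _) = (fun=> cst 0)); first exact: is_grad_cst.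
  by apply/funext => a; apply/funext => x; rewrite big_nil.
have := is_gradD (UG i) IH; congr (is_grad _ _).
  by apply/funext => x; rewrite big_cons.
by apply/funext => a; apply/funext => x; rewrite big_cons.
Qed.

Lemma is_grad_comp (phi phi' : R -> R) u g :
  (forall t : R, is_derive t (1 : R) phi (phi' t)) -> continuous phi' -> is_grad u g ->
  is_grad (phi \o u) (fun a x => phi' (u x) * g a x).
Proof.
move=> dphi cphi' ugH; have uc := is_grad_continuous ugH.
case: ugH => [ug gc]; split=> [x|a x].
  have dp : is_diff (u x) phi (fun t => t *: phi' (u x)).
    have [h1 h2] := dphi (u x); split; first exact/derivable1_diffP.
    by rewrite deriv1E// derive1E h2.
  apply: (@is_diff_eq _ _ _ _ _ _ _ (is_diff_comp (ug x) dp)).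
  apply/funext => y /=; rewrite /GRing.scale/= mulr_suml.
  by apply: eq_bigr => a _; ring.
apply: (continuousM _ (gc a x)).
exact: (continuous_comp (uc x) (cphi' (u x))).
Qed.

Lemma is_grad_derive_line u g (x z : 'rV[R]_d) (t : R) : is_grad u g ->
  is_derive t (1 : R) (fun s : R => u (x + s *: z)) (\sum_a z 0 a * g a (x + t *: z)).
Proof.
move=> [ug _].
have dl : is_diff t (fun s : R => x + s *: z) (fun s : R => s *: z).
  apply: (@is_diff_eq _ _ _ _ _ _ _ (is_diffD (is_diff_cst x t) (is_diff_scalel t z))).
  by apply/funext => y /=; rewrite !fctE /= add0r.
have := is_diff_comp dl (ug (x + t *: z)).
move=> [h1 h2]; split; first exact/diff_derivable.
by rewrite deriveE// h2 /= scale1r.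
Qed.

Lemma is_grad_MVT u g (x y : 'rV[R]_d) : is_grad u g ->
  exists2 t : R, 0 <= t <= 1 &
    u y - u x = \sum_a (y - x) 0 a * g a (x + t *: (y - x)).
Proof.
move=> ug.
have [] := @MVT_segment R (fun s => u (x + s *: (y - x)))
  (fun t => \sum_a (y - x) 0 a * g a (x + t *: (y - x))) 0 1 ler01.
- by move=> t _; apply: is_grad_derive_line.
- apply: continuous_subspaceT => t; apply: differentiable_continuous.
  by apply/derivable1_diffP; have [] := is_grad_derive_line x (y - x) t ug.
move=> t; rewrite in_itv/= => t01.
rewrite scale1r scale0r addr0 subr0 mulr1 [x + _]addrC subrK => ->.
by exists t.
Qed.

End Gradient.

Section Local.
Variables (R : realType) (d : nat).
Implicit Types (u v : 'rV[R]_d -> R) (g h : 'I_d -> 'rV[R]_d -> R) (x y : 'rV[R]_d).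

Lemma continuous_epsP (T : normedModType R) (u : T -> R) (x : T) :
  {for x, continuous u} <->
  (forall e : R, 0 < e -> exists2 r : R, 0 < r &
     forall y : T, `|y - x| < r -> `|u y - u x| <= e).
Proof.
split=> [uc e e0|h].
  have /cvgrPdist_le/(_ e e0)/nbhs_normP[r r0 hr] := uc.
  exists r => // y yx; rewrite distrC; apply: hr.
  by rewrite /= distrC.
apply/cvgrPdist_le => e e0; have [r r0 hr] := h e e0.
apply/nbhs_normP; exists r => // y /=; rewrite distrC => yx.
by rewrite distrC; exact: hr.
Qed.

Lemma half_gt0 (r : R) : 0 < r -> 0 < r / 2.
Proof. by move=> r0; rewrite divr_gt0. Qed.

Lemma near_norm_lt (T : normedModType R) (x : T) (r : R) : 0 < r ->
  \forall y \near x, `|x - y| < r.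
Proof. by move=> r0; apply/nbhs_normP; exists r. Qed.

Lemma continuous_sum_seq (T : topologicalType) (I : Type) (r : seq I) (F : I -> T -> R) :
  (forall i, continuous (F i)) -> continuous (fun t => \sum_(i <- r) F i t).
Proof.
move=> cF; elim: r => [|i r IH] t.
  rewrite (_ : (fun _ => _) = cst 0); first exact: cst_continuous.
  by apply/funext => s; rewrite big_nil.
rewrite (_ : (fun _ => _) = F i \+ (fun t => \sum_(i <- r) F i t)); last first.
  by apply/funext => s; rewrite big_cons.
exact: (continuousD (cF i t) (IH t)).
Qed.

Lemma compact_cball (M : R) : compact [set x : 'rV[R]_d | `|x| <= M].
Proof.
apply: bounded_closed_compact.
  exists M; split; first exact: num_real.
  by move=> N MN x /= xM; exact: le_trans xM (ltW MN).
rewrite (_ : [set x | _] = Num.norm @^-1` [set t : R | t <= M])//.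
apply: closed_comp; last exact: closed_le.
by move=> x _; exact: norm_continuous.
Qed.

Lemma continuous_bounded_cball u (M : R) : continuous u ->
  exists2 C : R, 0 <= C & forall x, `|x| <= M -> `|u x| <= C.
Proof.
move=> uc; have cu : {within [set x : 'rV[R]_d | `|x| <= M], continuous u}.
  exact: continuous_subspaceT.
have /compact_bounded[C [_ hC]] := continuous_compact cu (@compact_cball M).
exists (Num.max 0 (C + 1)); first by rewrite le_max lexx.
move=> x xM; rewrite le_max; apply/orP; right.
by apply: (hC (C + 1)); [rewrite ltrDl|exists x].
Qed.

(** Only [x] is confined to the ball: [y] may leave it, as the translates in the averages below do.
    The covering form of compactness gives this directly. *)
Lemma uniform_continuous_cball u (M e : R) : continuous u -> 0 < e ->
  exists2 r : R, 0 < r & forall x y, `|x| <= M -> `|y - x| <= r ->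
    `|u y - u x| <= e.
Proof.
move=> uc e0.
have /compact_near_coveringP nc := @compact_cball M.
have e20 : 0 < e / 2 by rewrite divr_gt0.
have := nc R (0 : R)^'+ (fun r x => forall y, `|y - x| <= r -> `|u y - u x| <= e) _.
case.
  move=> x _; have [r r0 hr] := (continuous_epsP u x).1 (uc x) _ e20.
  near=> x' s => /= y yx'.
  have x'x : `|x' - x| < r / 2.
    by rewrite distrC; near: x'; exact: (near_norm_lt x (half_gt0 r0)).
  have sr : s < r / 2 by near: s; apply: nbhs_right_lt; rewrite divr_gt0.
  have yx : `|y - x| < r.
    rewrite -(subrK x' y) -addrA (le_lt_trans (ler_normD _ _))//.
    by rewrite (splitr r) ler_ltD// (le_trans yx')// ltW.
  have x'xr : `|x' - x| < r by apply: lt_trans x'x _; lra.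
  rewrite -(subrK (u x) (u y)) -addrA (splitr e) (le_trans (ler_normD _ _))//.
  by rewrite lerD ?(distrC (u x)) ?hr.
move=> r /= r0 hr; exists (r / 2); first by rewrite divr_gt0.
move=> x y xM yx; apply: (hr (r / 2)) => //=; last by rewrite divr_gt0.
rewrite sub0r normrN gtr0_norm ?divr_gt0//; lra.
Unshelve. all: by end_near. Qed.

(** Strict differentiability, uniform over the ball. The segment from [x] to [y] stays within [r] of
    [x0] by convexity, so the mean value theorem and the uniform continuity of the gradient
    suffice. *)
Lemma is_grad_strict u g (M e : R) : is_grad u g -> 0 < e ->
  exists2 r : R, 0 < r & forall x0 x y, `|x0| <= M -> `|x - x0| <= r -> `|y - x0| <= r ->
    `|u y - u x - \sum_a (y - x) 0 a * g a x0| <= e * `|y - x|.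
Proof.
move=> ug e0; have gc := ug.2.
(* The share of each of the [d] summands; the successor keeps it positive when [d = 0]. *)
have e'0 : 0 < e / d.+1%:R by rewrite divr_gt0// ltr0n.
have [r r0 hr] : exists2 r : R, 0 < r & forall a x0 x, `|x0| <= M -> `|x - x0| <= r ->
    `|g a x - g a x0| <= e / d.+1%:R.
  have h a := uniform_continuous_cball M (gc a) e'0.
  pose rr a := sval (cid2 (h a)).
  exists (\big[Num.min/1]_a rr a).
    apply: lt_bigmin => // a _; rewrite /rr; by case: cid2.
  move=> a x0 x x0M xx0; have : `|x - x0| <= rr a.
    by apply: le_trans xx0 _; apply: bigmin_le.
  by rewrite /rr; case: cid2 => /= s s0 hs; exact: hs.
exists r => // x0 x y x0M xr yr.
have [t /andP[t0 t1] ->] := is_grad_MVT x y ug.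
rewrite -sumrB.
apply: (@le_trans _ _ (#|'I_d|%:R * (`|y - x| * (e / d.+1%:R)))).
  apply: ler_norm_sum_cst => [|a _].
    by rewrite mulr_ge0// ltW.
  rewrite -mulrBr normrM ler_pM//; first exact: rV_norm_coord.
  apply: hr => //.
  have -> : x + t *: (y - x) - x0 = (1 - t) *: (x - x0) + t *: (y - x0).
    by apply/rowP => b; rewrite !mxE; ring.
  apply: (le_trans (ler_normD _ _)); rewrite !normrZ.
  rewrite (ger0_norm t0) ger0_norm ?subr_ge0//.
  apply: (@le_trans _ _ ((1 - t) * r + t * r)); last by rewrite -mulrDl subrK mul1r.
  by rewrite lerD// ler_wpM2l// subr_ge0.
rewrite card_ord mulrCA [leRHS]mulrC ler_wpM2l//.
by rewrite mulrCA ler_piMr ?(ltW e0)// ler_pdivrMr ?ltr0n// mul1r ler_nat.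
Qed.

(** Turns an epsilon estimate into the little-o expansion that determines the differential; averages
    are differentiated through it. *)
Lemma is_diff_eps u (p : 'I_d -> R) x :
  (forall e : R, 0 < e -> exists2 r : R, 0 < r & forall y, `|y| <= r ->
    `|u (x + y) - u x - \sum_a y 0 a * p a| <= e * `|y|) ->
  is_diff x u (fun y : 'rV[R]_d => \sum_a y 0 a * p a).
Proof.
move=> h.
pose l (y : 'rV[R]_d) : R := \sum_a y 0 a * p a.
have lf : linear l.
  move=> c y z; rewrite /l /GRing.scale /= mulr_sumr -big_split.
  by apply: eq_bigr => a _; rewrite !mxE /=; ring.
pose lm := GRing.isLinear.Build R 'rV[R]_d R *:%R _ lf.
pose L : {linear 'rV[R]_d -> R} := HB.pack l lm.
have lc : continuous L.
  exact: (is_grad_continuous (is_grad_sum (index_enum 'I_d)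
    (fun a => is_gradM (is_grad_coord R a) (is_grad_cst d (p a))))).
have E : u \o shift x = cst (u x) + (L : 'rV[R]_d -> R) +o_ (0 : 'rV[R]_d) id.
  apply/eqaddoP => e e0; have [r r0 hr] := h e e0.
  have := near_norm_lt (0 : 'rV[R]_d) r0.
  apply: filterS => y /=; rewrite sub0r normrN => yr.
  have := hr y (ltW yr); rewrite !fctE /= opprD addrA [y + x]addrC.
  by [].
have Ed := diff_unique lc E.
split; last by rewrite Ed.
apply/diff_locallyP; split; first by rewrite Ed.
by rewrite E Ed.
Qed.

End Local.

Section Coordinates.
Variables (R : realType) (d : nat).

Definition is_grad2 (u : 'rV[R]_d -> R) g (h : 'I_d -> 'I_d -> 'rV[R]_d -> R) :=
  is_grad u g /\ forall a, is_grad (g a) (h a).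

Lemma mx_continuous_entry (T : topologicalType) p q (F : T -> 'M[R]_(p, q)) :
  (forall i j, continuous (fun x => F x i j)) -> continuous F.
Proof.
move=> h x A [P hP sA].
have : \forall y \near x, forall i j, P i j (F y i j).
  by apply: filter_forall => i; apply: filter_forall => j; exact: (h i j x).
by apply: filterS => y hy; exact: sA.
Qed.

Lemma is_diff_entry n (f : 'rV[R]_d -> 'rV[R]_n) x i : differentiable f x ->
  is_diff x (fun y => f y 0 i) (fun y => \sum_a y 0 a * Df f x i a).
Proof.
move=> fx; have ci := (is_grad_coord R i).1 (f x).
apply: (@is_diff_eq _ _ _ _ _ _ _ (is_diff_comp (differentiableP fx) ci)).
apply/funext => y /=; rewrite (bigD1 i)//= eqxx mulr1 big1 ?addr0; last first.
  by move=> b bi; rewrite (negbTE bi) mulr0.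
rewrite -[LHS]/(('d f x y : 'rV[R]_n) 0 i) -[in LHS](mul_rV_lin1 ('d f x) y) mxE.
by apply: eq_bigr => a _; rewrite /Df /jacobian !mxE.
Qed.

Lemma is_grad_entry n (f : 'rV[R]_d -> 'rV[R]_n) i : is_C1 f ->
  is_grad (fun x => f x 0 i) (fun a x => Df f x i a).
Proof.
move=> [df cf]; split=> [x|a]; first exact: is_diff_entry.
move=> x; exact: (continuous_comp (cf x) (@coord_continuous R n d i a _)).
Qed.

Lemma is_diff_inj (u : 'rV[R]_d -> R) x (p q : 'I_d -> R) a :
  is_diff x u (fun y : 'rV[R]_d => \sum_a y 0 a * p a) ->
  is_diff x u (fun y : 'rV[R]_d => \sum_a y 0 a * q a) -> p a = q a.
Proof.
move=> [_ hp] [_ hq].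
have S (r : 'I_d -> R) : \sum_b (delta_mx 0 a : 'rV[R]_d) 0 b * r b = r a.
  rewrite (bigD1 a)//= mxE !eqxx mul1r big1 ?addr0// => b ba.
  by rewrite mxE (negbTE ba) andbF mul0r.
by rewrite -(S p) -(S q); move: hp; rewrite hq => /(congr1 (fun F => F (delta_mx 0 a))) /= ->.
Qed.

Lemma is_C1_of_entries n (f : 'rV[R]_d -> 'rV[R]_n) (G : 'I_n -> 'I_d -> 'rV[R]_d -> R) :
  (forall i, is_grad (fun x => f x 0 i) (G i)) ->
  is_C1 f /\ (forall x i a, Df f x i a = G i a x).
Proof.
move=> fG.
have df x : differentiable f x.
  have -> : f = \sum_(i < n) (fun y => f y 0 i *: delta_mx 0 i).
    by apply/funext => y; rewrite fct_sumE -row_sum_delta.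
  apply: differentiable_sum => i; apply: differentiableZl.
  by have [] := (fG i).1 x.
have E x i a : Df f x i a = G i a x.
  exact: (is_diff_inj a (is_diff_entry i (df x)) ((fG i).1 x)).
split => //; split => //; apply: mx_continuous_entry => i a.
rewrite (_ : (fun x => _) = G i a); first exact: (fG i).2.
by apply/funext => x; rewrite E.
Qed.

Lemma is_grad2_entry n (f : 'rV[R]_d -> 'rV[R]_n) i : is_C2 f ->
  is_grad2 (fun x => f x 0 i) (fun a x => Df f x i a)
    (fun a b x => D2f f x (mxvec_index i a) b).
Proof.
move=> [C1f C1df]; split; first exact: is_grad_entry.
move=> a; have := is_grad_entry (mxvec_index i a) C1df.
by congr (is_grad _ _); apply/funext => x; rewrite /Dfvec mxvecE.
Qed.

Lemma is_C2_of_entries n (f : 'rV[R]_d -> 'rV[R]_n) G H :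
  (forall i, is_grad2 (fun x => f x 0 i) (G i) (H i)) ->
  [/\ is_C2 f, (forall x i a, Df f x i a = G i a x) &
      forall x i a b, D2f f x (mxvec_index i a) b = H i a b x].
Proof.
move=> fGH; have [C1f DfE] := is_C1_of_entries (fun i => (fGH i).1).
have [|C1df D2E] := @is_C1_of_entries _ (Dfvec f)
    (* The index [k] of the flattened Jacobian is decoded into its pair of row and column, which
       inverts [mxvec_index]. *)
    (fun k b x => let ia := enum_val (cast_ord (esym (mxvec_cast n d)) k) in H ia.1 ia.2 b x).
  move=> k; case/mxvec_indexP: k => i a.
  rewrite (_ : enum_val _ = (i, a)); last by rewrite /mxvec_index cast_ordK enum_rankK.
  have := (fGH i).2 a; congr (is_grad _ _).
  by apply/funext => x; rewrite /Dfvec mxvecE DfE.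
split => // x i a b; rewrite /D2f D2E.
by rewrite (_ : enum_val _ = (i, a))// /mxvec_index cast_ordK enum_rankK.
Qed.

Lemma is_grad2D u v g h G H : is_grad2 u g G -> is_grad2 v h H ->
  is_grad2 (fun x => u x + v x) (fun a x => g a x + h a x)
    (fun a b x => G a b x + H a b x).
Proof.
move=> [u1 u2] [v1 v2]; split; first exact: (is_gradD u1 v1).
by move=> a; exact: (is_gradD (u2 a) (v2 a)).
Qed.

Lemma is_grad2B u v g h G H : is_grad2 u g G -> is_grad2 v h H ->
  is_grad2 (fun x => u x - v x) (fun a x => g a x - h a x)
    (fun a b x => G a b x - H a b x).
Proof.
move=> [u1 u2] [v1 v2]; split; first exact: is_gradB.
by move=> a; exact: is_gradB.
Qed.

Lemma is_grad2M u v g h G H : is_grad2 u g G -> is_grad2 v h H ->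
  is_grad2 (fun x => u x * v x) (fun a x => u x * h a x + v x * g a x)
    (fun a b x => (u x * H a b x + h a x * g b x) + (v x * G a b x + g a x * h b x)).
Proof.
move=> [u1 u2] [v1 v2]; split; first exact: (is_gradM u1 v1).
by move=> a; exact: (is_gradD (is_gradM u1 (v2 a)) (is_gradM v1 (u2 a))).
Qed.

Lemma is_grad2_bounded_cball u g h (M : R) : is_grad2 u g h ->
  exists2 C : R, 0 <= C & forall x, `|x| <= M ->
    [/\ `|u x| <= C, forall a, `|g a x| <= C & forall a b, `|h a b x| <= C].
Proof.
move=> [ug gh].
have [C C0 uC] := continuous_bounded_cball M (is_grad_continuous ug).
have Cg a := continuous_bounded_cball M (ug.2 a).
have Ch a b := continuous_bounded_cball M ((gh a).2 b).
pose cg a := sval (cid2 (Cg a)); pose ch a b := sval (cid2 (Ch a b)).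
exists (C + \sum_a cg a + \sum_a \sum_b ch a b).
  rewrite !addr_ge0// ?sumr_ge0// => a _; first by rewrite /cg; case: cid2.
  by rewrite sumr_ge0// => b _; rewrite /ch; case: cid2.
have cg0 a : 0 <= cg a by rewrite /cg; case: cid2.
have ch0 a b : 0 <= ch a b by rewrite /ch; case: cid2.
have G0 : 0 <= \sum_a cg a by rewrite sumr_ge0.
have H0 : 0 <= \sum_a \sum_b ch a b by rewrite sumr_ge0// => a _; rewrite sumr_ge0.
move=> x xM; split.
- by apply: le_trans (uC x xM) _; rewrite -addrA lerDl addr_ge0.
- move=> a; have : `|g a x| <= cg a by rewrite /cg; case: cid2 => /= c _; exact.
  move=> h1; apply: le_trans h1 _; apply: (@le_trans _ _ (\sum_a cg a)).
    by rewrite (bigD1 a)//= lerDl sumr_ge0.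
  by rewrite addrAC lerDr addr_ge0.
move=> a b; have : `|h a b x| <= ch a b by rewrite /ch; case: cid2 => /= c _; exact.
move=> h1; apply: le_trans h1 _; apply: (@le_trans _ _ (\sum_a \sum_b ch a b)).
  rewrite (bigD1 a)//= (bigD1 b)//= -addrA lerDl addr_ge0 ?sumr_ge0// => c _.
  by rewrite sumr_ge0.
by rewrite lerDr addr_ge0.
Qed.

End Coordinates.

(** * The topology of C2 maps *)

Section FrobeniusNorm.
Variable R : realType.

Lemma enorm_ge0 p q (A : 'M[R]_(p, q)) : 0 <= enorm A.
Proof. exact: sqrtr_ge0. Qed.

Lemma sumsq_ge0 p q (A : 'M[R]_(p, q)) : 0 <= \sum_i \sum_j A i j ^+ 2.
Proof. by apply: sumr_ge0 => i _; apply: sumr_ge0 => j _; exact: sqr_ge0. Qed.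

Lemma enorm_sqr p q (A : 'M[R]_(p, q)) : enorm A ^+ 2 = \sum_i \sum_j A i j ^+ 2.
Proof. by rewrite sqr_sqrtr// sumsq_ge0. Qed.

Lemma enorm_entry p q (A : 'M[R]_(p, q)) i j : `|A i j| <= enorm A.
Proof.
rewrite -(@ler_pXn2r _ 2)// ?nnegrE ?enorm_ge0// enorm_sqr real_normK ?num_real//.
rewrite (bigD1 i)//= (bigD1 j)//= -addrA lerDl addr_ge0//.
  by apply: sumr_ge0 => k _; exact: sqr_ge0.
by apply: sumr_ge0 => k _; apply: sumr_ge0 => l _; exact: sqr_ge0.
Qed.

Lemma enorm_le p q (A : 'M[R]_(p, q)) (e : R) : (forall i j, `|A i j| <= e) ->
  0 <= e -> enorm A <= (p * q)%:R * e.
Proof.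
move=> h e0; case: (posnP (p * q)) => [pq0|pq0].
  rewrite pq0 mul0r /enorm.
  suff -> : \sum_i \sum_j A i j ^+ 2 = 0 by rewrite sqrtr0.
  apply: big1 => i _; apply: big1 => j _.
  have := muln_gt0 p q; rewrite pq0 ltnn (leq_ltn_trans _ (ltn_ord i))//.
  by rewrite (leq_ltn_trans _ (ltn_ord j)).
rewrite -(@ler_pXn2r _ 2)// ?nnegrE ?enorm_ge0 ?mulr_ge0// enorm_sqr.
apply: (@le_trans _ _ (\sum_(i < p) \sum_(j < q) e ^+ 2)).
  apply: ler_sum => i _; apply: ler_sum => j _.
  by rewrite -(real_normK (num_real (A i j))) ler_pXn2r// nnegrE.
rewrite !sumr_const !card_ord -mulrnA -[leLHS]mulr_natl exprMn (mulnC q).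
rewrite ler_wpM2r ?sqr_ge0// -natrX ler_nat expnS expn1.
by rewrite -[leqLHS]muln1 leq_mul2l pq0 orbT.
Qed.

(** Minkowski's inequality by weighted arithmetic and geometric means. The weights are quotients of
    the two norms, so vanishing norms are split off. *)
Lemma enormD p q (A B : 'M[R]_(p, q)) : enorm (A + B) <= enorm A + enorm B.
Proof.
have [A0|A0] := eqVneq (enorm A) 0.
  suff -> : A = 0 by rewrite add0r lerDr enorm_ge0.
  apply/matrixP => i j; rewrite mxE; apply/eqP; rewrite -normr_le0 -A0.
  exact: enorm_entry.
have [B0|B0] := eqVneq (enorm B) 0.
  suff -> : B = 0 by rewrite addr0 lerDl enorm_ge0.
  apply/matrixP => i j; rewrite mxE; apply/eqP; rewrite -normr_le0 -B0.
  exact: enorm_entry.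
have {}A0 : 0 < enorm A by rewrite lt_def A0 enorm_ge0.
have {}B0 : 0 < enorm B by rewrite lt_def B0 enorm_ge0.
rewrite -(@ler_pXn2r _ 2)// ?nnegrE ?addr_ge0 ?enorm_ge0// enorm_sqr.
(* [2 a b <= (|B| / |A|) a^2 + (|A| / |B|) b^2] *)
apply: (@le_trans _ _ ((1 + enorm B / enorm A) * (\sum_i \sum_j A i j ^+ 2)
   + (1 + enorm A / enorm B) * (\sum_i \sum_j B i j ^+ 2))).
  rewrite !mulr_sumr -big_split; apply: ler_sum => i _ /=.
  rewrite !mulr_sumr -big_split; apply: ler_sum => j _ /=; rewrite mxE.
  rewrite -subr_ge0.
  have -> : (1 + enorm B / enorm A) * A i j ^+ 2 +
    (1 + enorm A / enorm B) * B i j ^+ 2 - (A i j + B i j) ^+ 2 =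
    (enorm B * A i j - enorm A * B i j) ^+ 2 / (enorm A * enorm B).
    by field; rewrite !gt_eqF.
  by rewrite divr_ge0 ?sqr_ge0// mulr_ge0// ltW.
rewrite -!enorm_sqr le_eqVlt; apply/orP; left; apply/eqP; field.
by rewrite !gt_eqF.
Qed.

End FrobeniusNorm.

Lemma mx_addE (V : zmodType) p q (A B : 'M[V]_(p, q)) i j :
  (A + B) i j = A i j + B i j.
Proof. by rewrite mxE. Qed.

Lemma mx_subE (V : zmodType) p q (A B : 'M[V]_(p, q)) i j :
  (A - B) i j = A i j - B i j.
Proof. by rewrite !mxE. Qed.

Section C2norm.
Variables (R : realType) (d m : nat).
Implicit Types (f g h : 'rV[R]_d -> 'rV[R]_m).

Lemma is_C2B f g : is_C2 f -> is_C2 g ->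
  [/\ is_C2 (fun x => f x - g x),
      (forall x, Df (fun x => f x - g x) x = Df f x - Df g x) &
      (forall x, D2f (fun x => f x - g x) x = D2f f x - D2f g x)].
Proof.
move=> fC gC.
have [i|h1 h2 h3] := @is_C2_of_entries R d m (fun x => f x - g x)
  (fun i a x => Df f x i a - Df g x i a)
  (fun i a b x => D2f f x (mxvec_index i a) b - D2f g x (mxvec_index i a) b).
  have := is_grad2B (is_grad2_entry i fC) (is_grad2_entry i gC).
  by congr is_grad2; apply/funext => x; rewrite !mxE.
split; first exact: h1.
  by move=> x; apply/matrixP => i a; rewrite h2 mx_subE.
by move=> x; apply/matrixP => k b; case/mxvec_indexP: k => i a; rewrite h3 mx_subE.
Qed.

Lemma is_C2D f g : is_C2 f -> is_C2 g ->
  [/\ is_C2 (fun x => f x + g x),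
      (forall x, Df (fun x => f x + g x) x = Df f x + Df g x) &
      (forall x, D2f (fun x => f x + g x) x = D2f f x + D2f g x)].
Proof.
move=> fC gC.
have [i|h1 h2 h3] := @is_C2_of_entries R d m (fun x => f x + g x)
  (fun i a x => Df f x i a + Df g x i a)
  (fun i a b x => D2f f x (mxvec_index i a) b + D2f g x (mxvec_index i a) b).
  have := is_grad2D (is_grad2_entry i fC) (is_grad2_entry i gC).
  by congr is_grad2; apply/funext => x; rewrite !mxE.
split; first exact: h1.
  by move=> x; apply/matrixP => i a; rewrite h2 mx_addE.
by move=> x; apply/matrixP => k b; case/mxvec_indexP: k => i a; rewrite h3 mx_addE.
Qed.

Lemma C2norm_triangle f g : is_C2 f -> is_C2 g ->
  (C2norm (fun x => f x + g x)%R <= C2norm f + C2norm g)%E.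
Proof.
move=> fC gC; have [_ DE D2E] := is_C2D fC gC.
apply: ub_ereal_sup => _ [x _ <-]; rewrite DE D2E.
pose N h := Num.max (enorm (h x)) (Num.max (enorm (Df h x)) (enorm (D2f h x))).
apply: (@le_trans _ _ ((N f)%:E + (N g)%:E)%E); last first.
  by apply: leeD; apply: ereal_sup_ubound; exists x.
rewrite -EFinD lee_fin !ge_max; apply/andP; split; [|apply/andP; split];
  apply: (le_trans (enormD _ _)); rewrite lerD// /N !le_max lexx ?orbT//.
Qed.

Lemma C2norm_entries h (e : R) : (C2norm h < e%:E)%E ->
  forall x, [/\ forall i, `|h x 0 i| <= e, forall i a, `|Df h x i a| <= e &
    forall i a b, `|D2f h x (mxvec_index i a) b| <= e].
Proof.
move=> he x.
have : ((Num.max (enorm (h x))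
   (Num.max (enorm (Df h x)) (enorm (D2f h x))))%:E <= C2norm h)%E.
  by apply: ereal_sup_ubound; exists x.
move=> /le_lt_trans/(_ he); rewrite lte_fin !gt_max => /and3P[h0 h1 h2].
split=> [i|i a|i a b]; first exact: le_trans (enorm_entry _ _ _) (ltW h0).
- exact: le_trans (enorm_entry _ _ _) (ltW h1).
- exact: le_trans (enorm_entry _ _ _) (ltW h2).
Qed.

Lemma C2norm_le h (e : R) : 0 <= e ->
  (forall x, [/\ forall i, `|h x 0 i| <= e, forall i a, `|Df h x i a| <= e &
    forall i a b, `|D2f h x (mxvec_index i a) b| <= e]) ->
  (C2norm h <= ((m + m * d + m * d * d)%:R * e)%:E)%E.
Proof.
move=> e0 H; apply: ub_ereal_sup => _ [x _ <-]; have [H0 H1 H2] := H x.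
rewrite lee_fin !ge_max; apply/and3P; split.
- apply: le_trans (enorm_le _ e0) _ => [i j|]; first by rewrite ord1.
  by rewrite ler_wpM2r// ler_nat mul1n -addnA leq_addr.
- apply: le_trans (enorm_le _ e0) _ => [i j|]; first exact: H1.
  by rewrite ler_wpM2r// ler_nat addnAC leq_addl.
- apply: le_trans (enorm_le _ e0) _ => [k j|].
    by case/mxvec_indexP: k => i a.
  by rewrite ler_wpM2r// ler_nat leq_addl.
Qed.

Lemma open_C2ball (f : C2 R d m) (r : R) : 0 < r -> open (C2ball (f, r)).
Proof.
move=> r0; exists [set C2ball (f, r)]; last by rewrite bigcup_set1.
move=> _ ->; exact: (@finI_from1 _ _ [set fe : C2 R d m * R | 0 < fe.2] _ (f, r)).
Qed.

Lemma C2ball_center (f : C2 R d m) (r : R) : 0 < r -> C2ball (f, r) f.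
Proof.
move=> r0; rewrite /C2ball/=.
have [h1 h2 h3] := is_C2B (C2_funP f) (C2_funP f).
apply: (@le_lt_trans _ _ 0%E); last by rewrite lte_fin.
have := @C2norm_le (f \- f) 0 (lexx _); rewrite mulr0; apply => x.
split=> [i|i a|i a b].
- by rewrite !mxE subrr normr0.
- by rewrite h2 subrr mxE normr0.
- by rewrite h3 subrr mxE normr0.
Qed.

(** The balls are declared only as a subbase, with arbitrary centres. The triangle inequality
    recentres each of finitely many balls at [f], and the least radius serves for all. *)
Lemma open_C2_ball_sub (O : set (C2 R d m)) (f : C2 R d m) : open O -> O f ->
  exists2 r : R, 0 < r & C2ball (f, r) `<=` O.
Proof.
move=> [D' sD' <-] [B /[dup] D'B /sD' [E0 _ BE0] Bf].
pose E : {fset (C2 R d m * R)%type} := E0.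
have BE : \bigcap_(fe in [set` E]) C2ball fe = B := BE0.
have {}Bf : B f := Bf.
suff [r r0 hr] : exists2 r : R, 0 < r &
    forall fe, fe \in E -> C2ball (f, r) `<=` C2ball fe.
  exists r => // g gr; suff Bg : B g by exists B.
  rewrite -BE => fe /= feE.
  exact: hr feE _ gr.
have H (fe : C2 R d m * R) : fe \in E -> exists2 r : R, 0 < r &
    C2ball (f, r) `<=` C2ball fe.
  move=> feE; have : C2ball fe f by move: Bf; rewrite -BE; apply.
  case: fe feE => k e feE; rewrite /C2ball/= => fk.
  have N0 : (0%E <= C2norm (f \- k)%R)%E.
    apply: (@le_trans _ _ (Num.max (enorm ((f \- k) 0))
      (Num.max (enorm (Df (f \- k) 0)) (enorm (D2f (f \- k) 0))))%R%:E).
      by rewrite lee_fin le_max enorm_ge0.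
    by apply: ereal_sup_ubound; exists 0.
  (* The distance between two maps may be infinite, but not here, since [f] lies in the ball around
     [k]. *)
  have fin : C2norm (f \- k)%R \is a fin_num.
    by rewrite ge0_fin_numE// (lt_trans fk)// ltey.
  move: fk; rewrite -(fineK fin) lte_fin => fk.
  exists (e - fine (C2norm (f \- k)%R)); first by rewrite subr_gt0.
  move=> g /= gf.
  have -> : (g \- k) = (fun x => (g \- f) x + (f \- k)%R x).
    by apply/funext => x /=; rewrite subrKA.
  have [gfC _ _] := is_C2B (C2_funP g) (C2_funP f).
  have [fkC _ _] := is_C2B (C2_funP f) (C2_funP k).
  apply: (le_lt_trans (C2norm_triangle gfC fkC)).
  rewrite -[C2norm (f \- k)%R](fineK fin).
  by move: gf; rewrite -lteBrDr ?EFinB.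
have : forall s : seq (C2 R d m * R), {subset s <= E} -> exists2 r : R, 0 < r &
    forall fe, fe \in s -> C2ball (f, r) `<=` C2ball fe.
  elim=> [_|fe s IH sE']; first by exists 1.
  have [r1 r10 h1] := H fe (sE' _ (mem_head _ _)).
  have [|r2 r20 h2] := IH; first by move=> x xs; apply: sE'; rewrite inE xs orbT.
  exists (Num.min r1 r2); first by rewrite lt_min r10.
  have le_ball (r s' : R) : r <= s' -> C2ball (f, r) `<=` C2ball (f, s').
    by move=> rs g; rewrite /C2ball/= => /lt_le_trans; apply; rewrite lee_fin.
  move=> ge; rewrite inE => /predU1P[->|ges].
    by apply: subset_trans h1; apply: le_ball; rewrite ge_min lexx.
  by apply: subset_trans (h2 _ ges); apply: le_ball; rewrite ge_min lexx orbT.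
by move/(_ (enum_fset E)); apply.
Qed.

End C2norm.

(** * Pigeonhole and covering arguments *)

Section Pigeonhole.
Variable R : realType.

Lemma exists_cells (I : finType) (N : nat) (B : R) : (0 < N)%N -> 0 < B ->
  exists cell : (I -> R) -> {ffun I -> 'I_N}, forall z z',
    (forall i, `|z i| <= B) -> (forall i, `|z' i| <= B) -> cell z = cell z' ->
    forall i, `|z i - z' i| <= 3 * B / N%:R.
Proof.
case: N => // N _ B0.
(* Dividing by [3 * B] instead of [2 * B] keeps [t x] strictly below the number of cells even at
   [x = B], so that its truncation is an index. *)
pose t (x : R) := N.+1%:R * ((x + B) / (3 * B)).
have tB x : `|x| <= B -> 0 <= t x < N.+1%:R.
  rewrite ler_norml => /andP[x1 x2]; rewrite /t mulr_ge0//=; last first.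
    by rewrite divr_ge0//; lra.
  rewrite -[ltRHS]mulr1 ltr_pM2l ?ltr0n// ltr_pdivrMr; lra.
exists (fun z => [ffun i => inord (Num.truncn (t (z i)))]).
move=> z z' zB z'B /ffunP + i => /(_ i); rewrite !ffunE => /(congr1 val).
have L x : `|x| <= B -> (Num.truncn (t x) < N.+1)%N.
  by move=> /tB/andP[t0 tN]; rewrite -(ltr_nat R) (le_lt_trans _ tN)// truncn_le.
rewrite /= !inordK ?L// => E.
have /andP[z0 _] := tB _ (zB i); have /andP[z'0 _] := tB _ (z'B i).
have := truncn_itv z0; have := truncn_itv z'0; rewrite E.
set k := (Num.truncn _)%:R; rewrite -natr1 => /andP[a1 a2] /andP[b1 b2].
have : `|t (z i) - t (z' i)| <= 1 by rewrite ler_norml; lra.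
have -> : t (z i) - t (z' i) = (z i - z' i) * (N.+1%:R / (3 * B)).
  by rewrite /t; field; rewrite gt_eqF.
have c0 : 0 < N.+1%:R / (3 * B) by rewrite divr_gt0 ?ltr0n//; lra.
rewrite normrM (gtr0_norm c0) -ler_pdivlMr// => /le_trans; apply.
by rewrite mul1r invf_div.
Qed.

(** Because [c ^ k * M ^ k < M ^ k.+1] as soon as [M] exceeds [c ^ k]. *)
Lemma exists_pow_gap (c k l : nat) : (k < l)%N ->
  exists2 M : nat, (0 < M)%N & ((c * M) ^ k < M ^ l)%N.
Proof.
move=> kl; exists (c ^ k).+1 => //; rewrite expnMn.
apply: (@leq_trans ((c ^ k).+1 ^ k.+1)); last by rewrite leq_pexp2l.
by rewrite [ltnRHS]expnS ltn_pmul2r ?expn_gt0.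
Qed.

(* Pigeonhole: a grid of parameters has [M ^ #|J|] points, while [S] splits
   into only [(c * M) ^ #|I|] cells on which [T] varies by less than its mesh. *)
Lemma lipschitz_image_avoid_type (I J : finType) (S : Type) (pi : S -> I -> R)
    (T : S -> J -> R) (B C e : R) : (#|I| < #|J|)%N ->
  (forall s i, `|pi s i| <= B) ->
  (forall s s' r, (forall i, `|pi s i - pi s' i| <= r) ->
    forall j, `|T s j - T s' j| <= C * r) -> 0 < e ->
  exists p : J -> R, (forall j, `|p j| <= e) /\
    exists2 n : R, 0 < n & forall s, exists j, n < `|T s j - p j|.
Proof.
move=> IJ piB TL e0.
pose B' := Num.max B 1; have B'0 : 0 < B' by rewrite lt_max ltr01 orbT.
pose C' := Num.max C 1; have C'0 : 0 < C' by rewrite lt_max ltr01 orbT.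
(* With [c * M] cells per axis, [T] varies inside a cell by at most a third of the mesh [e / M] of
   the grid [q]. *)
pose c := (Num.truncn (C' * (3 * B') * 3 / e)).+1.
have [M M0 hM] := exists_pow_gap c IJ.
have M0R : 0 < M%:R :> R by rewrite ltr0n.
have cM0 : (0 < c * M)%N by rewrite muln_gt0.
have [cell hcell] := exists_cells I cM0 B'0.
pose q (f : {ffun J -> 'I_M}) j : R := e * (f j)%:R / M%:R.
(* Chosen so that [e / (3 * M) + 2 * n] is still less than the mesh. *)
pose n := e / (4 * M%:R).
have n0 : 0 < n by rewrite divr_gt0// mulr_gt0.
(* Otherwise each grid point has some [s] with [T s] within [n] of it. Two grid points whose [s]
   share a cell would be closer than the mesh, so the grid would inject into the cells. *)
apply: contrapT => H.
have {}H f : exists s, forall j, `|T s j - q f j| <= n.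
  apply: contrapT => Hf; apply: H; exists (q f); split.
    move=> j; rewrite /q ger0_norm ?divr_ge0 ?mulr_ge0 ?(ltW e0)//.
    by rewrite ler_pdivrMr// ler_wpM2l ?(ltW e0)// ler_nat ltnW.
  exists n => // s; apply: contrapT => Hs; apply: Hf; exists s => j.
  by rewrite leNgt; apply/negP => h; apply: Hs; exists j.
pose s f := sval (cid (H f)).
have hs f j : `|T (s f) j - q f j| <= n by rewrite /s; case: cid.
have : injective (fun f => cell (pi (s f))).
  move=> f f' E; apply/ffunP => j; apply/val_inj.
  have pB s0 i : `|pi s0 i| <= B' by rewrite le_max piB.
  have D := hcell _ _ (pB (s f)) (pB (s f')) E.
  have D' := TL _ _ _ D j.
  have D2 : C * (3 * B' / (c * M)%:R) <= e / (3 * M%:R).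
    apply: (@le_trans _ _ (C' * (3 * B' / (c * M)%:R))).
      by rewrite ler_wpM2r ?le_max ?lexx// divr_ge0// mulr_ge0// ltW.
    rewrite natrM; have : C' * (3 * B') * 3 / e < c%:R by exact: truncnS_gt.
    have c0 : 0 < c%:R :> R by rewrite ltr0n.
    rewrite ltr_pdivrMr// => cB.
    rewrite mulrA ler_pdivrMr ?mulr_gt0//.
    have -> : e / (3 * M%:R) * (c%:R * M%:R) = c%:R * e / 3.
      by field; rewrite gt_eqF.
    by rewrite ler_pdivlMr// ltW.
  have Q : `|q f j - q f' j| < e / M%:R.
    have -> : q f j - q f' j = (T (s f) j - T (s f') j) - (T (s f) j - q f j)
        + (T (s f') j - q f' j) by ring.
    apply: (le_lt_trans (ler_normD _ _)).
    apply: (@le_lt_trans _ _ (e / (3 * M%:R) + n + n)).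
      rewrite lerD// (le_trans (ler_normB _ _))// lerD//.
      exact: le_trans D' D2.
    have -> : e / (3 * M%:R) + n + n = (5 / 6) * (e / M%:R).
      by rewrite /n; field; rewrite gt_eqF.
    by rewrite gtr_pMl ?divr_gt0//; lra.
  apply/eqP; apply: contraT => neq.
  suff : e / M%:R <= `|q f j - q f' j| by rewrite leNgt Q.
  rewrite /q -mulrBl -mulrBr !normrM (gtr0_norm e0) (@gtr0_norm _ M%:R^-1) ?invr_gt0//.
  rewrite ler_wpM2r ?invr_ge0 ?(ltW M0R)// ler_peMr ?(ltW e0)//.
  case: (ltngtP (f j) (f' j)) neq => // [lt|lt] _.
    rewrite distrC -natrB ?(ltnW lt)// normr_nat ler1n subn_gt0//.
  by rewrite -natrB ?(ltnW lt)// normr_nat ler1n subn_gt0.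
move=> /leq_card; rewrite !card_ffun !card_ord leqNgt.
by rewrite hM.
Qed.

(** The form with subsets allows normalised coordinates, which are constant, to be left out of the
    count. Outside [B] the parameter is set to 0. *)
Lemma lipschitz_image_avoid (I J : finType) (A : {set I}) (B : {set J})
    (S : Type) (pi : S -> I -> R) (T : S -> J -> R) (M C e : R) :
  (#|A| < #|B|)%N ->
  (forall s i, i \in A -> `|pi s i| <= M) ->
  (forall s s' r, (forall i, i \in A -> `|pi s i - pi s' i| <= r) ->
    forall j, j \in B -> `|T s j - T s' j| <= C * r) -> 0 < e ->
  exists p : J -> R, (forall j, `|p j| <= e) /\
    exists2 n : R, 0 < n & forall s, exists2 j, j \in B & n < `|T s j - p j|.
Proof.
move=> AB piM TL e0.
have [|||//|p [pe [n n0 hn]]] := @lipschitz_image_avoid_type {i | i \in A} {j | j \in B} S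
    (fun s i => pi s (val i)) (fun s j => T s (val j)) M C e.
- by rewrite !card_sig.
- by move=> s i; apply: piM; exact: (valP i).
- move=> s s' r h j; apply: TL (valP j) => i iA.
  exact: (h (exist _ i iA)).
exists (fun j => if insub j is Some k then p k else 0); split.
  by move=> j; case: insubP => [k _ _|_]; rewrite ?normr0 ?(ltW e0).
exists n => // s; have [j hj] := hn s; exists (val j); first exact: (valP j).
by rewrite valK.
Qed.

End Pigeonhole.

(** * Covering numbers and Hausdorff measure *)

Section Covering.
Variables (R : realType) (d : nat).

(** Boundedness of the upper Minkowski content of dimension [s]. It is stronger than finite
    Hausdorff measure, is proved by counting cells at each scale, and passes to finite unions.
    Restricting to [e <= 1] makes it monotone in [s]. *)
Definition small_cover (s : nat) (A : set 'rV[R]_d) : Prop :=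
  exists C : R, forall e : R, 0 < e -> e <= 1 -> exists L : seq (set 'rV[R]_d),
    [/\ A `<=` \bigcup_(U in [set` L]) U,
        (forall U x y, U \in L -> U x -> U y -> enorm (x - y) <= e) &
        (size L)%:R * e ^+ s <= C].

Lemma small_cover_sub s A B : A `<=` B -> small_cover s B -> small_cover s A.
Proof.
move=> AB [C h]; exists C => e e0 e1; have [L [BL LD Ls]] := h e e0 e1.
by exists L; split => //; apply: subset_trans BL.
Qed.

Lemma small_coverU s A B : small_cover s A -> small_cover s B ->
  small_cover s (A `|` B).
Proof.
move=> [C h] [C' h']; exists (C + C') => e e0 e1.
have [L [AL LD Ls]] := h e e0 e1; have [L' [BL' LD' Ls']] := h' e e0 e1.
exists (L ++ L'); split.
- move=> x [/AL[U /= UL Ux]|/BL'[U /= UL Ux]]; exists U => //=;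
    by rewrite mem_cat UL ?orbT.
- by move=> U x y; rewrite mem_cat => /orP[/LD|/LD']; apply.
- by rewrite size_cat natrD mulrDl lerD.
Qed.

Lemma small_cover0 s : small_cover s set0.
Proof.
exists 0 => e e0 e1; exists [::]; split => //.
by rewrite mul0r.
Qed.

Lemma small_cover_bigU s (I : Type) (r : seq I) (F : I -> set 'rV[R]_d) :
  (forall i, small_cover s (F i)) -> small_cover s (\big[setU/set0]_(i <- r) F i).
Proof.
move=> h; elim: r => [|i r IH]; first by rewrite big_nil; exact: small_cover0.
by rewrite big_cons; apply: small_coverU.
Qed.

Lemma small_coverW s s' A : (s <= s')%N -> small_cover s A -> small_cover s' A.
Proof.
move=> ss [C h]; exists C => e e0 e1; have [L [AL LD Ls]] := h e e0 e1.
exists L; split => //; apply: le_trans Ls; rewrite ler_wpM2l//.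
by rewrite ler_wiXn2l// ltW.
Qed.

(** The points [x s] with [pi s] in a given cell of a [k]-dimensional grid form a set of small
    diameter. The hypothesis makes [x] a Lipschitz function of [pi] without constructing that
    function. *)
Lemma small_cover_lipschitz k (S : Type) (D : set S) (x : S -> 'rV[R]_d)
    (pi : S -> 'I_k -> R) (B C : R) : (forall s i, D s -> `|pi s i| <= B) ->
  (forall s s' r, D s -> D s' -> 0 <= r -> (forall i, `|pi s i - pi s' i| <= r) ->
     `|x s - x s'| <= C * r) ->
  small_cover k (x @` D).
Proof.
move=> piB xL.
pose B' := Num.max B 1; have B'0 : 0 < B' by rewrite lt_max ltr01 orbT.
pose C' := Num.max C 1; have C'0 : 0 < C' by rewrite lt_max ltr01 orbT.
pose Q := d.+1%:R * (C' * (3 * B')); have Q0 : 0 < Q.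
  by rewrite !mulr_gt0 ?ltr0n.
exists ((Q + 1) ^+ k) => e e0 e1.
(* Above [Q / e], so that the pieces have diameter at most [e], and by at most 1, so that
   [N * e <= Q + 1] bounds their number [N ^ k] against [e ^+ k]. *)
pose N := (Num.truncn (Q / e)).+1.
have QN : Q / e < N%:R by exact: truncnS_gt.
have NQ : N%:R * e <= Q + 1.
  rewrite /N -natr1 mulrDl mul1r lerD// -ler_pdivlMr//.
  by rewrite truncn_le// divr_ge0// ltW.
have N0R : 0 < N%:R :> R by rewrite ltr0n.
have [cell hcell] := @exists_cells R 'I_k N B' (ltn0Sn _) B'0.
pose P f : set 'rV[R]_d := [set x s | s in [set s | D s /\ cell (pi s) = f]].
exists [seq P f | f : {ffun 'I_k -> 'I_N}]; split.
- move=> _ [s Ds <-]; exists (P (cell (pi s))); last by exists s.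
  by apply/mapP; exists (cell (pi s)) => //; rewrite mem_enum.
- move=> _ y z /mapP[f _ ->] [s [Ds sf] <-] [s' [Ds' sf'] <-].
  have pB s0 i : D s0 -> `|pi s0 i| <= B' by move=> ?; rewrite le_max piB.
  have h := hcell _ _ (fun i => pB s i Ds) (fun i => pB s' i Ds') (etrans sf (esym sf')).
  have h' : `|x s - x s'| <= C' * (3 * B' / N%:R).
    have r0 : 0 <= 3 * B' / N%:R by rewrite divr_ge0// mulr_ge0// ltW.
    apply: le_trans (xL _ _ _ Ds Ds' r0 h) _.
    by rewrite ler_wpM2r// le_max lexx.
  have c1 i j : `|(x s - x s') i j| <= C' * (3 * B' / N%:R).
    by rewrite ord1; apply: le_trans h'; exact: rV_norm_coord.
  have c2 : 0 <= C' * (3 * B' / N%:R).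
    by rewrite (mulr_ge0 (ltW C'0))// divr_ge0// mulr_ge0// ltW.
  apply: (le_trans (enorm_le c1 c2)).
  rewrite mul1n; apply: (@le_trans _ _ (Q / N%:R)).
    have -> : Q / N%:R = d.+1%:R * (C' * (3 * B' / N%:R)) by rewrite /Q !mulrA.
    by rewrite ler_wpM2r// ler_nat.
  by rewrite ler_pdivrMr// mulrC -ler_pdivrMr// ltW.
- rewrite size_map -cardE card_ffun !card_ord natrX -exprMn.
  by rewrite lerXn2r// nnegrE ?(mulr_ge0 _ (ltW e0))// addr_ge0// ltW.
Qed.

Lemma small_cover_hausdorff s A : small_cover s A -> (hausdorff s A < +oo)%E.
Proof.
move=> [C h]; apply: (@le_lt_trans _ _ C%:E); last exact: ltey.
apply: ub_ereal_sup => _ [delta /= delta0 <-].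
pose e := Num.min delta 1.
have e0 : 0 < e by rewrite lt_min delta0 ltr01.
have e1 : e <= 1 by rewrite ge_min lexx orbT.
have [L [AL LD Ls]] := h e e0 e1.
(* The finite cover is continued by empty sets, which [diam_pow] counts as 0. *)
pose U k := nth (set0 : set 'rV[R]_d) L k.
have UD k x y : U k x -> U k y -> enorm (x - y) <= e.
  rewrite /U; have [kL|kL] := ltnP k (size L); last by rewrite nth_default.
  by apply: LD; rewrite mem_nth.
apply: (@le_trans _ _ (\sum_(0 <= k <oo) diam_pow s (U k))%E).
  apply: ereal_inf_lbound; exists U => //; split.
    move=> x /AL[V /= VL Vx]; exists (index V L) => //.
    by rewrite /U nth_index.
  move=> k; apply: ub_ereal_sup => _ [[x y] [/= Ux Uy] <-].
  by rewrite lee_fin (le_trans (UD _ _ _ Ux Uy))// ge_min lexx.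
rewrite (@nneseries_split _ _ 0 (size L)); last first.
  move=> k _; rewrite /diam_pow; case: asboolP => // -[x Ux].
  apply: expe_ge0; apply: ereal_sup_ubound; exists (x, x) => //=.
  rewrite subrr /enorm; congr (_%:E).
  rewrite big1 ?sqrtr0// => i _; rewrite big1// => j _.
  by rewrite mxE expr0n.
rewrite add0n eseries0 ?adde0; last first.
  move=> k kL; rewrite /diam_pow /U nth_default//.
  by case: asboolP => // -[].
apply: (@le_trans _ _ (\sum_(0 <= k < size L) (e ^+ s)%:E)%E).
  apply: lee_sum => k _; rewrite /diam_pow; case: asboolP => [[x Ux]|_]; last first.
    by rewrite lee_fin exprn_ge0// ltW.
  have d0 : (0 <= ediam (U k))%E.
    apply: ereal_sup_ubound; exists (x, x) => //=.
    rewrite subrr /enorm; congr (_%:E).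
    rewrite big1 ?sqrtr0// => i _; rewrite big1// => j _.
    by rewrite mxE expr0n.
  have de : (ediam (U k) <= e%:E)%E.
    by apply: ub_ereal_sup => _ [[y z] [/= Uy Uz] <-]; rewrite lee_fin; exact: UD Uy Uz.
  have fin : ediam (U k) \is a fin_num.
    by rewrite ge0_fin_numE// (le_lt_trans de)// ltey.
  move: d0 de; rewrite -(fineK fin) !lee_fin => d0 de.
  by rewrite -EFin_expe lee_fin lerXn2r ?nnegrE ?(le_trans d0 de).
rewrite sumEFin lee_fin sumr_const_nat subn0 -[_ *+ _]mulr_natl//.
Qed.

End Covering.

(** * The zero set of a regular map *)

Section LinearAlgebra.
Variable R : realType.

Lemma norm_mulmx_le n k (B : 'M[R]_(n, k)) :
  exists2 C : R, 0 <= C & forall y : 'rV[R]_n, `|y *m B| <= C * `|y|.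
Proof.
exists (\sum_i \sum_j `|B i j|); first by rewrite sumr_ge0// => i _; rewrite sumr_ge0.
move=> y; apply/rV_norm_le.
  by rewrite mulr_ge0// sumr_ge0// => i _; rewrite sumr_ge0.
move=> j; rewrite mxE (le_trans (ler_norm_sum _ _ _))// mulr_suml ler_sum// => i _.
rewrite normrM mulrC ler_pM// ?rV_norm_coord//.
by rewrite (bigD1 j)//= lerDl sumr_ge0.
Qed.

Lemma norm_lsubmx_le n k (z : 'rV[R]_(n + k)) : `|lsubmx z| <= `|z|.
Proof.
by apply/rV_norm_le => // j; rewrite mxE rV_norm_coord.
Qed.

Lemma norm_rsubmx_le n k (z : 'rV[R]_(n + k)) : `|rsubmx z| <= `|z|.
Proof.
by apply/rV_norm_le => // j; rewrite mxE rV_norm_coord.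
Qed.

(** In the coordinates [y *m E], with [E] the column basis change of [A], the first [r] entries are
    controlled by [y *m A] and the other [N - r] by [rho]. This is the linear part of the implicit
    function theorem. *)
Lemma full_col_rank_bound N r (A : 'M[R]_(N, r)) :
  (forall u : 'cV_r, A *m u = 0 -> u = 0) ->
  exists (E : 'M[R]_N) (C : R), 0 <= C /\ forall (y : 'rV_N) (rho : R), 0 <= rho ->
    (forall i : 'I_N, (r <= i)%N -> `|(y *m E) 0 i| <= rho) ->
    `|y| <= C * (`|y *m A| + rho).
Proof.
move=> Ainj.
have rA : \rank A = r.
  have : row_free A^T.
    apply: inj_row_free => v vA; apply: trmx_inj; rewrite trmx0; apply: Ainj.
    by apply: trmx_inj; rewrite trmx_mul trmxK trmx0.
  by rewrite /row_free mxrank_tr => /eqP.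
pose E := col_ebase A.
have Eu : E \in unitmx by exact: col_ebase_unit.
have [C1 C10 h1] := norm_mulmx_le (invmx E).
have [C2 C20 h2] := norm_mulmx_le (invmx (row_ebase A)).
exists E, (C1 * (C2 + 1)); split; first by rewrite mulr_ge0// addr_ge0.
move=> y rho rho0 hrho.
rewrite -{1}(mulmxK Eu y); apply: (le_trans (h1 _)); rewrite -mulrA ler_wpM2l//.
have yA : y *m A *m invmx (row_ebase A) = y *m E *m pid_mx r.
  rewrite -{1}(mulmx_ebase A) rA !mulmxA mulmxK ?row_ebase_unit//.
have b0 : 0 <= C2 * `|y *m A| + rho by rewrite addr_ge0// mulr_ge0.
apply: (@le_trans _ _ (C2 * `|y *m A| + rho)); last first.
  by rewrite mulrDl mul1r mulrDr lerD ?lerD// ?lerDr ?lerDl ?mulr_ge0// addrCA lerDl addr_ge0// mulr_ge0.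
apply/rV_norm_le => // i; have [ri|ir] := leqP r i.
  by rewrite (le_trans (hrho i ri))// lerDr mulr_ge0.
have -> : (y *m E) 0 i = (y *m E *m pid_mx r) 0 (Ordinal ir).
  rewrite [RHS]mxE (bigD1 i)//=.
  have -> : (pid_mx r : 'M[R]_(N, r)) i (Ordinal ir) = 1 by rewrite mxE/= eqxx ir.
  rewrite mulr1 big1 ?addr0// => k ki.
  have -> : (pid_mx r : 'M[R]_(N, r)) k (Ordinal ir) = 0.
    by rewrite mxE/= (_ : (k == i :> nat) = false) ?val_eqE ?(negbTE ki).
  by rewrite mulr0.
rewrite -yA (le_trans (rV_norm_coord _ _))// (le_trans (h2 _))// lerDl//.
Qed.

End LinearAlgebra.

Section RegularZeros.
Variables (R : realType) (d m : nat).
Implicit Types (P : 'I_m -> 'I_d -> R) (H : 'I_m -> 'I_d -> 'I_d -> R).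

(* [P] and [H] stand for the first and second derivatives of [f] at [x].  For
   [c = 0] this says that [w] is in the left kernel of [Df] and that [v] is
   orthogonal to the range of the derivative of [(x, w) |-> w *m Df f x]. *)
Definition degenerate (c : R) P H (w : 'rV[R]_m) (v : 'rV[R]_d) : Prop :=
  [/\ forall a, `|\sum_i w 0 i * P i a| <= c,
      forall i, `|\sum_a P i a * v 0 a| <= c &
      forall b, `|\sum_i \sum_a w 0 i * v 0 a * H i a b| <= c].

(** Since [c] does not depend on the triple, the condition survives small perturbations. The single
    bound [M] for [x], [w] and [v] leaves a countable family of conditions, indexed by integers [M]
    and the pairs [(j, l)]. *)
Definition regular_on (P : 'I_m -> 'I_d -> 'rV[R]_d -> R)
    (H : 'I_m -> 'I_d -> 'I_d -> 'rV[R]_d -> R) (M : R) (j : 'I_m) (l : 'I_d) : Prop :=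
  exists2 c : R, 0 < c & forall (x : 'rV[R]_d) (w : 'rV[R]_m) (v : 'rV[R]_d),
    `|x| <= M -> `|w| <= M -> w 0 j = 1 -> `|v| <= M -> v 0 l = 1 ->
    ~ degenerate c (fun i a => P i a x) (fun i a b => H i a b x) w v.

Variables (P : 'I_m -> 'I_d -> 'rV[R]_d -> R)
  (H : 'I_m -> 'I_d -> 'I_d -> 'rV[R]_d -> R).
Hypothesis PH : forall i a, is_grad (P i a) (H i a).
Variables (M : R) (j : 'I_m).
Hypothesis M1 : 1 <= M.
Hypothesis reg : forall l, regular_on P H M j l.

Definition kernel_pairs : set 'rV[R]_(d + m) :=
  [set z | [/\ `|z| <= M, rsubmx z 0 j = 1 &
    forall a, \sum_i rsubmx z 0 i * P i a (lsubmx z) = 0]].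

(** The derivative at [z = (x, w)] of the map sending [(x, w)] to [w *m Df f x] followed by the
    entry [w j], acting on row vectors from the right. *)
Let A (z : 'rV[R]_(d + m)) : 'M[R]_(d + m, d + 1) :=
  block_mx (\matrix_(b, a) \sum_i rsubmx z 0 i * H i a b (lsubmx z)) 0
           (\matrix_(i, a) P i a (lsubmx z)) (\matrix_(i, k) (i == j)%:R).

(** For [u = (v, s)] in the kernel, [Df v] is [- s] times the [j]-th basis vector. Pairing with [w],
    which annihilates [Df] and has [w j = 1], gives [s = 0]. A nonzero [v] could then be rescaled to
    a degenerate triple. *)
Lemma kernel_pairs_full_rank z : kernel_pairs z ->
  forall u : 'cV_(d + 1), A z *m u = 0 -> u = 0.
Proof.
move=> [zM wj G0] u.
rewrite -(vsubmxK u) /A mul_block_col mul0mx addr0 => /eqP.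
rewrite col_mx_eq0 => /andP[/eqP E1 /eqP E2].
set v := usubmx u in E1 E2 *; set s := dsubmx u in E2 *.
set w := rsubmx z in wj G0 E1 E2 *; set x := lsubmx z in G0 E1 E2 *.
have wM : `|w| <= M by exact: le_trans (norm_rsubmx_le z) zM.
have xM : `|x| <= M by exact: le_trans (norm_lsubmx_le z) zM.
clearbody v s w x.
have {}E1 b : \sum_i \sum_a w 0 i * v a 0 * H i a b x = 0.
  move/colP: E1 => /(_ b); rewrite !mxE => E; rewrite -[RHS]E exchange_big.
  apply: eq_bigr => a _; rewrite mxE mulr_suml; apply: eq_bigr => i _ /=; ring.
have {}E2 i : \sum_a P i a x * v a 0 + (i == j)%:R * s 0 0 = 0.
  move/colP: E2 => /(_ i); rewrite mx_addE [RHS]mxE => E; rewrite -[RHS]E.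
  rewrite [X in _ = X + _]mxE [X in _ = _ + X]mxE big_ord1 [X in _ = _ + X * _]mxE.
  by congr (_ + _); apply: eq_bigr => a _; rewrite mxE.
have s0 : s 0 0 = 0.
  have : \sum_i w 0 i * (\sum_a P i a x * v a 0 + (i == j)%:R * s 0 0) = 0.
    by rewrite big1// => i _; rewrite E2 mulr0.
  under eq_bigr do rewrite mulrDr mulr_sumr.
  rewrite big_split/= exchange_big/= [X in X + _]big1 ?add0r; last first.
    move=> a _; under eq_bigr do rewrite mulrA; rewrite -mulr_suml G0 mul0r//.
  rewrite (bigD1 j)//= wj eqxx !mul1r big1 ?addr0// => i ij.
  by rewrite (negbTE ij) mul0r mulr0.
have {}E2 i : \sum_a P i a x * v a 0 = 0 by move: (E2 i); rewrite s0 mulr0 addr0.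
suff v0 : v = 0.
  rewrite v0 (_ : s = 0) ?col_mx0//.
  by apply/matrixP => i k; rewrite !ord1 s0 mxE.
have [v0|vn0] := eqVneq `|v^T| 0.
  by apply: trmx_inj; rewrite trmx0; apply/eqP; rewrite -normr_eq0 v0.
(* An entry of largest modulus, so that after division by it [v] has norm 1, hence at most [M]. *)
have [[i l] vl] := mx_norm_neq0 vn0; rewrite /= ord1 mxE in vl.
have vl' : `|v^T| = `|v l 0| by exact: vl.
have vl0 : v l 0 != 0 by rewrite -normr_eq0 -vl'.
exfalso; have [c c0] := reg l; apply.
- exact: xM.
- exact: wM.
- exact: wj.
- apply: le_trans M1; rewrite -(_ : `|(v l 0)^-1 *: v^T| = 1); first exact: lexx.
  by rewrite normrZ vl' -normrM mulVf// normr1.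
- by rewrite !mxE mulVf.
split=> [a|i'|b].
- by rewrite G0 normr0 ltW.
- have -> : \sum_a P i' a x * ((v l 0)^-1 *: v^T) 0 a = (v l 0)^-1 * \sum_a P i' a x * v a 0.
    by rewrite mulr_sumr; apply: eq_bigr => a _; rewrite !mxE; ring.
  by rewrite E2 mulr0 normr0 ltW.
have -> : \sum_i \sum_a w 0 i * ((v l 0)^-1 *: v^T) 0 a * H i a b x =
    (v l 0)^-1 * \sum_i \sum_a w 0 i * v a 0 * H i a b x.
  rewrite mulr_sumr; apply: eq_bigr => i' _; rewrite mulr_sumr.
  by apply: eq_bigr => a _; rewrite !mxE; ring.
by rewrite E1 mulr0 normr0 ltW.
Qed.

(** The defining equations take equal values at [z] and [z'], so the derivative frozen at [z0] sends
    [z - z'] to the error of the linearisation, which strict differentiability bounds. *)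
Lemma kernel_pairs_almost_linear z0 (e : R) : kernel_pairs z0 -> 0 < e ->
  exists2 r : R, 0 < r & forall z z', kernel_pairs z -> kernel_pairs z' ->
    `|z - z0| <= r -> `|z' - z0| <= r -> `|(z - z') *m A z0| <= e * `|z - z'|.
Proof.
move=> Zz0 e0.
have m0 : 0 < m%:R :> R by rewrite ltr0n; case: (m) j => // -[].
(* Each of the [m] summands below may cost [e / m]: half of it pays for [e1 + M * e1], the other
   half for the term with [r0]. *)
pose e1 := e / (4 * M * m%:R).
have M0 : 0 < M by exact: lt_le_trans M1.
have e10 : 0 < e1 by rewrite divr_gt0// !mulr_gt0.
have hS i a := is_grad_strict M (PH i a) e10.
have hU i a := uniform_continuous_cball M (is_grad_continuous (PH i a)) e10.
pose rS i a := sval (cid2 (hS i a)); pose rU i a := sval (cid2 (hU i a)).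
have [CH CH0 hH] : exists2 CH : R, 0 <= CH & forall i a b, `|H i a b (lsubmx z0)| <= CH.
  exists (\sum_i \sum_a \sum_b `|H i a b (lsubmx z0)|).
    by rewrite sumr_ge0// => i _; rewrite sumr_ge0// => a _; rewrite sumr_ge0.
  move=> i a b; rewrite (bigD1 i)//= (bigD1 a)//= (bigD1 b)//= -!addrA lerDl.
  rewrite !addr_ge0 ?sumr_ge0// => k _; rewrite sumr_ge0// => k' _; rewrite sumr_ge0//.
pose r0 := e / (2 * m%:R * (d%:R * CH + 1)).
have r00 : 0 < r0 by rewrite divr_gt0// !mulr_gt0// ltr_wpDl// mulr_ge0.
pose r := Num.min r0 (\big[Num.min/1]_i \big[Num.min/1]_a Num.min (rS i a) (rU i a)).
have rgt0 : 0 < r.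
  rewrite lt_min r00; apply: lt_bigmin => // i _; apply: lt_bigmin => // a _.
  by rewrite lt_min /rS /rU; case: cid2 => /= ? ->; case: cid2.
have rr i a : r <= Num.min (rS i a) (rU i a).
  rewrite ge_min; apply/orP; right; 
  apply: (@le_trans _ _ (\big[Num.min/1]_a Num.min (rS i a) (rU i a))).
    exact: (bigmin_le _ i (fun i => \big[Num.min/1]_a Num.min (rS i a) (rU i a))).
  exact: (bigmin_le _ a (fun a => Num.min (rS i a) (rU i a))).
exists r => // z z' [zM wj G0] [z'M wj' G0'] zr z'r.
apply/rV_norm_le; first by rewrite mulr_ge0// ltW.
move=> k; rewrite -{1}(hsubmxK (z - z')) /A mul_row_block mulmx0 add0r.
case: (splitP k) => [a ka|k' kk'].
  have -> : k = lshift 1 a by exact: val_inj.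
  rewrite row_mxEl.
  set w := rsubmx z in wj G0; set x := lsubmx z in G0.
  set w' := rsubmx z' in wj' G0'; set x' := lsubmx z' in G0'.
  have -> : lsubmx (z - z') = x - x' by apply/rowP => b; rewrite !mxE.
  have -> : rsubmx (z - z') = w - w' by apply/rowP => b; rewrite !mxE.
  set w0 := rsubmx z0; set x0 := lsubmx z0.
  have xx : `|x - x'| <= `|z - z'|.
    have -> : x - x' = lsubmx (z - z') by apply/rowP => b; rewrite !mxE.
    exact: norm_lsubmx_le.
  have ww i : `|w 0 i - w' 0 i| <= `|z - z'|.
    have -> : w 0 i - w' 0 i = (z - z') 0 (rshift d i) by rewrite !mxE.
    exact: rV_norm_coord.
  have xx0 : `|x - x0| <= r.
    have -> : x - x0 = lsubmx (z - z0) by apply/rowP => b; rewrite !mxE.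
    exact: le_trans (norm_lsubmx_le _) zr.
  have x'x0 : `|x' - x0| <= r.
    have -> : x' - x0 = lsubmx (z' - z0) by apply/rowP => b; rewrite !mxE.
    exact: le_trans (norm_lsubmx_le _) z'r.
  have ww0 i : `|w 0 i - w0 0 i| <= r.
    have -> : w 0 i - w0 0 i = (z - z0) 0 (rshift d i) by rewrite !mxE.
    exact: le_trans (rV_norm_coord _ _) zr.
  have x0M : `|x0| <= M by case: Zz0 => z0M _ _; exact: le_trans (norm_lsubmx_le _) z0M.
  have wM i : `|w 0 i| <= M.
    by apply: le_trans zM; apply: le_trans (norm_rsubmx_le z); exact: rV_norm_coord.
  pose D i := \sum_b (x - x') 0 b * H i a b x0.
  (* Both kernel equations are subtracted here, so that only products with a small factor remain. *)
  have -> : ((x - x') *m (\matrix_(b, a) \sum_i w0 0 i * H i a b x0) +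
     (w - w') *m (\matrix_(i, a) P i a x0)) 0 a =
     \sum_i ((w 0 i - w' 0 i) * (P i a x0 - P i a x')
       - w 0 i * (P i a x - P i a x' - D i) - (w 0 i - w0 0 i) * D i).
    rewrite mx_addE !mxE.
    have -> : \sum_b (x - x') 0 b * (\matrix_(b, a) \sum_i w0 0 i * H i a b x0) b a =
       \sum_i w0 0 i * D i.
      under eq_bigr do rewrite mxE mulr_sumr; rewrite exchange_big/=.
      by apply: eq_bigr => i _; rewrite /D mulr_sumr; apply: eq_bigr => b _; ring.
    have -> : \sum_i (w - w') 0 i * (\matrix_(i, a) P i a x0) i a =
       \sum_i (w 0 i - w' 0 i) * P i a x0 by apply: eq_bigr => i _; rewrite !mxE.
    rewrite -big_split/=; apply/eqP; rewrite -subr_eq0 -sumrB.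
    have : \sum_i w 0 i * P i a x - \sum_i w' 0 i * P i a x' = 0 by rewrite G0 G0' subrr.
    by rewrite -sumrB => E; rewrite -[X in _ == X]E; apply/eqP/eq_bigr => i _; ring.
  have Dle i : `|D i| <= d%:R * CH * `|z - z'|.
    rewrite -mulrA -{1}(card_ord d); apply: ler_norm_sum_cst; first by rewrite mulr_ge0.
    move=> b _; rewrite normrM mulrC ler_pM// (le_trans _ xx)//.
    exact: rV_norm_coord.
  apply: (@le_trans _ _ (#|'I_m|%:R * (e / m%:R * `|z - z'|))); last first.
    by rewrite card_ord mulrA [m%:R * _]mulrCA divff ?mulr1// gt_eqF.
  apply: ler_norm_sum_cst; first by rewrite mulr_ge0// divr_ge0// ltW.
  move=> i _.
  have T1 : `|P i a x0 - P i a x'| <= e1.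
    rewrite distrC; move: (rr i a); rewrite /rU; case: cid2 => s /= s0 hs.
    rewrite le_min => /andP[_ rs]; apply: hs => //; exact: le_trans x'x0 rs.
  have T2 : `|P i a x - P i a x' - D i| <= e1 * `|z - z'|.
    move: (rr i a); rewrite /rS; case: cid2 => s /= s0 hs.
    rewrite le_min => /andP[rs _].
    apply: (le_trans (hs x0 x' x x0M (le_trans x'x0 rs) (le_trans xx0 rs))).
    by rewrite ler_wpM2l// ltW.
  have T3 : `|w 0 i - w0 0 i| <= r0.
    by apply: (le_trans (ww0 i)); rewrite ge_min lexx.
  apply: (le_trans (ler_normB _ _)); rewrite normrM.
  apply: (@le_trans _ _ (`|z - z'| * e1 + M * (e1 * `|z - z'|) +
    r0 * (d%:R * CH * `|z - z'|))).
    rewrite lerD ?ler_pM// (le_trans (ler_normB _ _))// !normrM lerD ?ler_pM//.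
  have -> : `|z - z'| * e1 + M * (e1 * `|z - z'|) + r0 * (d%:R * CH * `|z - z'|) =
     (e1 + M * e1 + r0 * (d%:R * CH)) * `|z - z'| by ring.
  rewrite ler_wpM2r//.
  have h1 : e1 + M * e1 <= e / (2 * m%:R).
    have -> : e / (2 * m%:R) = 2 * M * e1 by rewrite /e1; field; rewrite !gt_eqF.
    have : e1 <= M * e1 by rewrite ler_peMl// ltW.
    by rewrite -mulrA; lra.
  have h2 : r0 * (d%:R * CH) <= e / (2 * m%:R).
    have D1 : 0 < d%:R * CH + 1 by rewrite ltr_wpDl// mulr_ge0.
    have -> : e / (2 * m%:R) = r0 * (d%:R * CH + 1).
      by rewrite /r0; field; rewrite !gt_eqF.
    by rewrite ler_wpM2l ?(ltW r00)// lerDl.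
  have -> : e / m%:R = e / (2 * m%:R) + e / (2 * m%:R) by field; rewrite gt_eqF.
  exact: lerD.
have -> : k = rshift d k' by exact: val_inj.
(* The last column gives the change of the entry [w j], which is 1 at both points. *)
rewrite row_mxEr mxE big1 ?normr0 ?mulr_ge0 ?(ltW e0)// => i _.
rewrite !mxE; case: eqVneq => [->|_]; last by rewrite mulr0.
by move: wj wj'; rewrite !mxE => -> ->; rewrite subrr mul0r.
Qed.

(** Combining the two previous estimates, [|z - z'|] is at most [C * e * |z - z'| + C * rho], where
    [rho] bounds the change of the free coordinates. As [C * e <= 1 / 2], the first term is absorbed
    and [2 * C] is a Lipschitz constant. *)
Lemma kernel_pairs_local_cover z0 : kernel_pairs z0 ->
  exists2 r : R, 0 < r & small_cover m.-1
    ((fun z : 'rV[R]_(d + m) => lsubmx z) @` [set z | kernel_pairs z /\ `|z0 - z| < r]).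
Proof.
move=> Zz0.
have [E [C [C0 hC]]] := full_col_rank_bound (kernel_pairs_full_rank Zz0).
pose e := 1 / (2 * (C + 1)).
have e0 : 0 < e by rewrite divr_gt0// mulr_gt0// ltr_wpDl.
have [r r0 hr] := kernel_pairs_almost_linear Zz0 e0.
exists r => //.
have [CE CE0 hE] := norm_mulmx_le E.
have kN (k : 'I_m.-1) : (d + 1 + k < d + m)%N.
  by rewrite -addnA ltn_add2l add1n; case: (m) k => [[]//|m' k] /=; rewrite ltnS.
(* The free coordinates: the last [m - 1] of the [d + m], after the [d + 1] that [A z0] controls. *)
pose pi (z : 'rV[R]_(d + m)) (k : 'I_m.-1) := (z *m E) 0 (Ordinal (kN k)).
apply: (@small_cover_lipschitz R d _ _ _ _ pi (CE * M) (2 * C)).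
  move=> z k [[zM _ _] _]; apply: (le_trans (rV_norm_coord _ _)).
  by apply: (le_trans (hE z)); rewrite ler_wpM2l.
move=> z z' rho [Zz zr] [Zz' z'r] rho0 hpi.
have h1 : `|(z - z') *m A z0| <= e * `|z - z'|.
  by apply: hr => //; rewrite distrC ltW.
have h2 : `|z - z'| <= C * (`|(z - z') *m A z0| + rho).
  apply: hC => // i ri.
  have iN : (i - (d + 1) < m.-1)%N.
    have := ltn_ord i; move: ri; clear; case: (m) i => [|m'] i; lia.
  have -> : i = Ordinal (kN (Ordinal iN)).
    by apply: val_inj; rewrite /= subnKC.
  by have := hpi (Ordinal iN); rewrite /pi mulmxBl !mxE.
have Ce : C * e <= 1 / 2.
  rewrite /e mulrA mulr1 ler_pdivrMr ?mulr_gt0 ?ltr_wpDl//; lra.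
apply: (@le_trans _ _ `|z - z'|).
  have -> : lsubmx z - lsubmx z' = lsubmx (z - z') by apply/rowP => b; rewrite !mxE.
  exact: norm_lsubmx_le.
have : `|z - z'| <= C * e * `|z - z'| + C * rho.
  apply: (le_trans h2); rewrite mulrDr lerD2r -mulrA ler_wpM2l//.
have : C * e * `|z - z'| <= 1 / 2 * `|z - z'| by rewrite ler_wpM2r.
lra.
Qed.

Lemma kernel_pairs_closed : closed kernel_pairs.
Proof.
have cl : continuous (fun z : 'rV[R]_(d + m) => lsubmx z : 'rV[R]_d).
  apply: mx_continuous_entry => i k.
  rewrite (_ : (fun z => _) = fun z : 'rV[R]_(d + m) => z i (lshift m k)).
    exact: coord_continuous.
  by apply/funext => z; rewrite mxE.
have cr i : continuous (fun z : 'rV[R]_(d + m) => rsubmx z 0 i : R).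
  rewrite (_ : (fun z => _) = fun z : 'rV[R]_(d + m) => z 0 (rshift d i)).
    exact: coord_continuous.
  by apply/funext => z; rewrite mxE.
have cP i a : continuous (fun z : 'rV[R]_(d + m) => P i a (lsubmx z)).
  move=> z; apply: (@continuous_comp _ _ _ (fun z : 'rV[R]_(d + m) => lsubmx z) (P i a)).
    exact: cl.
  exact: (is_grad_continuous (PH i a)).
have csum a : continuous (fun z : 'rV[R]_(d + m) =>
    \sum_i rsubmx z 0 i * P i a (lsubmx z)).
  apply: continuous_sum_seq => i z; exact: (continuousM (cr i z) (cP i a z)).
rewrite (_ : kernel_pairs = (Num.norm @^-1` [set t : R | t <= M]) `&`
  (((fun z : 'rV[R]_(d + m) => rsubmx z 0 j : R) @^-1` [set 1]) `&`
  \bigcap_a ((fun z : 'rV[R]_(d + m) =>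
    \sum_i rsubmx z 0 i * P i a (lsubmx z)) @^-1` [set 0]))); last first.
  apply/seteqP; split => z.
    by move=> [h1 h2 h3]; split => //; split => // a _; exact: h3.
  by move=> [h1 [h2 h3]]; split => // a; exact: h3.
apply: closedI; first by apply: preimage_closed; [move=> z _; exact: norm_continuous|exact: closed_le].
apply: closedI.
  by apply: preimage_closed; [move=> z _; exact: cr|exact: closed_eq].
apply: closed_bigI => a _.
by apply: preimage_closed; [move=> z _; exact: csum|exact: closed_eq].
Qed.

Lemma kernel_pairs_cover :
  small_cover m.-1 ((fun z : 'rV[R]_(d + m) => lsubmx z) @` kernel_pairs).
Proof.
have cK : compact kernel_pairs.
  by apply: (subclosed_compact kernel_pairs_closed (@compact_cball R _ M)) => z [].
move: cK; rewrite compact_cover => cK.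
(* The value 1 elsewhere makes the radius a total function, as the covering form of compactness
   requires. *)
pose r z := if pselect (kernel_pairs z) is left h
  then sval (cid2 (kernel_pairs_local_cover h)) else 1.
pose V z : set 'rV[R]_(d + m) := [set y | `|z - y| < r z].
have Vcov z : kernel_pairs z -> small_cover m.-1
    ((fun z : 'rV[R]_(d + m) => lsubmx z) @` [set y | kernel_pairs y /\ V z y]).
  by rewrite /V /r => h; case: pselect => // h'; case: cid2.
have [|z Zz|D' sD' hD'] := cK 'rV[R]_(d + m) kernel_pairs V.
- move=> z Zz; rewrite (_ : V z = ball z (r z)); last by rewrite -ball_normE.
  by apply: ball_open; rewrite /r; case: pselect => // h; case: cid2.
- exists z => //; rewrite /V/= subrr normr0 /r.
  by case: pselect => // h; case: cid2.
apply: (@small_cover_sub R d _ _ (\big[setU/set0]_(z <- enum_fset D')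
  ((fun z : 'rV[R]_(d + m) => lsubmx z) @` [set y | kernel_pairs y /\ (z \in D') /\ V z y]))).
  move=> _ [y Zy <-]; have [z /= zD' Vzy] := hD' y Zy.
  by rewrite -bigcup_seq; exists z => //; exists y.
apply: small_cover_bigU => z; have [zD|zD] := boolP (z \in D').
  apply: small_cover_sub (Vcov z _); last by have := sD' _ zD; rewrite inE.
  by move=> _ [y [Zy [_ Vy]] <-]; exists y.
apply: small_cover_sub (@small_cover0 R d _).
by move=> _ [y [_ [zD' _]] <-].
Qed.

End RegularZeros.

(** * Smoothing by averages *)

Section Mean.
Variable R : realType.
Implicit Types (phi psi : R -> R) (a b c : R).
Let mu := @lebesgue_measure R.

Lemma integrable_itv phi a b : continuous phi ->
  mu.-integrable `[a, b] (EFin \o phi).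
Proof.
move=> cphi; apply: continuous_compact_integrable; first exact: segment_compact.
exact: continuous_subspaceT.
Qed.

Lemma Rintegral_itv_split phi a b c : continuous phi -> a <= b -> b <= c ->
  \int[mu]_(x in `[a, c]) phi x =
  \int[mu]_(x in `[a, b]) phi x + \int[mu]_(x in `[b, c]) phi x.
Proof.
move=> cphi ab bc.
have := @Rintegral_itvB R phi (BLeft a) (BRight c) b (integrable_itv a c cphi).
rewrite !bnd_simp => /(_ ab bc).
rewrite Rintegral_itv_obnd_cbnd => [<-|]; first by rewrite addrC subrK.
apply: integrableS (integrable_itv b c cphi) => //.
exact: subset_itv_oc_cc.
Qed.

Lemma Rintegral_itv_bound phi a b C : continuous phi -> a <= b ->
  (forall t, a <= t <= b -> `|phi t| <= C) ->
  `|\int[mu]_(x in `[a, b]) phi x| <= C * (b - a).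
Proof.
move=> cphi ab hC.
have cn : continuous (fun t => `|phi t|).
  by move=> t; apply: continuous_comp; [exact: cphi|exact: norm_continuous].
apply: (le_trans (le_normr_Rintegral _ _)) => //; first exact: integrable_itv.
apply: (@le_trans _ _ (\int[mu]_(x in `[a, b]) C)).
  apply: le_Rintegral => //.
  - exact: integrable_itv.
  - by apply: (@integrable_itv (cst C)); exact: cst_continuous.
rewrite Rintegral_cst//= lebesgue_measure_itv/= lte_fin.
case: ltP => [_|ba]; first by rewrite -EFinB.
by rewrite (_ : b = a) ?subrr//; apply/eqP; rewrite eq_le ab ba.
Qed.

Definition mean phi := \int[mu]_(x in `[0, 1]) phi x.

Lemma mean_close phi psi C : continuous phi -> continuous psi ->
  (forall t, 0 <= t <= 1 -> `|phi t - psi t| <= C) -> `|mean phi - mean psi| <= C.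
Proof.
move=> cphi cpsi h; rewrite /mean -RintegralB//; [|exact: integrable_itv..].
have := @Rintegral_itv_bound (fun t => phi t - psi t) 0 1 C.
rewrite subr0 mulr1; apply => // t.
exact: (continuousB (cphi t) (cpsi t)).
Qed.

Lemma mean_cst C : mean (fun _ => C) = C.
Proof. by rewrite /mean Rintegral_cst//= lebesgue_measure_itv/= lte_fin ltr01 -EFinB subr0 mulr1. Qed.

Lemma meanD phi psi : continuous phi -> continuous psi ->
  mean (fun t => phi t + psi t) = mean phi + mean psi.
Proof. by move=> cphi cpsi; rewrite /mean RintegralD//; exact: integrable_itv. Qed.

Lemma meanZ C phi : continuous phi -> mean (fun t => C * phi t) = C * mean phi.
Proof. by move=> cphi; rewrite /mean RintegralZl//; exact: integrable_itv. Qed.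

Lemma mean_sum (I : Type) (r : seq I) (F : I -> R -> R) :
  (forall i, continuous (F i)) ->
  mean (fun t => \sum_(i <- r) F i t) = \sum_(i <- r) mean (F i).
Proof.
move=> cF; elim: r => [|i r IH].
  by under [in LHS]eq_fun do rewrite big_nil; rewrite mean_cst big_nil.
under [in LHS]eq_fun do rewrite big_cons.
rewrite meanD ?IH ?big_cons//; exact: continuous_sum_seq.
Qed.

(** The source of all gain in regularity: the integrals over [[s, 1 + s]] and [[0, 1]] differ by
    integrals over two intervals of length [s]. *)
Lemma mean_shift phi s C : continuous phi -> 0 <= s ->
  (forall t, 0 <= t <= 1 + s -> `|phi t| <= C) ->
  `|mean (fun t => phi (t + s)) - mean phi| <= 2 * C * s.
Proof.
move=> cphi s0 hC.
have cs : continuous (fun t : R => t + s).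
  by move=> t; apply: (continuousD (@cvg_id _ _)); exact: cvg_cst.
have d1 : derive1 (fun t : R => t + s) = cst 1.
  apply/funext => t; rewrite derive1E deriveD//= derive_id derive_cst addr0//.
have -> : mean (fun t => phi (t + s)) = \int[mu]_(x in `[s, 1 + s]) phi x.
  have := @integration_by_substitution_increasing R (fun t => t + s) phi 0 1 ler01.
  rewrite add0r /mean /Rintegral => ->.
  - congr fine; apply: eq_integral => t _ /=.
    by rewrite fctE /= d1 /= mulr1.
  - by move=> x y _ _ xy; rewrite ltrD2r.
  - by rewrite d1 => ? ?; exact: cvg_cst.
  - by rewrite d1; exact: is_cvg_cst.
  - by rewrite d1; exact: is_cvg_cst.
  - split.
    + by move=> x _; exact: derivableD.
    + by apply: cvg_at_right_filter; exact: cs.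
    + by apply: cvg_at_left_filter; exact: cs.
  - exact: continuous_subspaceT.
have e1 := @Rintegral_itv_split phi 0 s (1 + s) cphi s0 _.
have e2 := @Rintegral_itv_split phi 0 1 (1 + s) cphi ler01 _.
have -> : \int[mu]_(x in `[s, 1 + s]) phi x - mean phi =
   \int[mu]_(x in `[1, 1 + s]) phi x - \int[mu]_(x in `[0, s]) phi x.
  have := e1; rewrite e2 ?lerDl// /mean => /(_ (ler_wpDl ler01 (lexx _))) E.
  move: E; set X1 := Rintegral _ _ _; set X2 := Rintegral _ _ _.
  set X3 := Rintegral _ _ _; set X4 := Rintegral _ _ _.
  lra.
apply: (le_trans (ler_normB _ _)).
have -> : 2 * C * s = C * ((1 + s) - 1) + C * (s - 0) by ring.
apply: lerD; apply: Rintegral_itv_bound => //; rewrite ?lerDl//.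
  by move=> t /andP[t1 t2]; apply: hC; rewrite t2 (le_trans ler01).
by move=> t /andP[t1 t2]; apply: hC; rewrite t1 (le_trans t2)// lerDr.
Qed.

End Mean.

Section Averaging.
Variables (R : realType) (d : nat).
Implicit Types (u : 'rV[R]_d -> R) (x y z : 'rV[R]_d).

Definition dir (k : 'I_d) : 'rV[R]_d := delta_mx 0 k.

Lemma norm_dir_le k (t : R) : `|t *: dir k| <= `|t|.
Proof.
apply/rV_norm_le => // a; rewrite !mxE eqxx/=.
by case: (a == k); rewrite ?mulr1 ?mulr0 ?normr0.
Qed.

(** The Steklov average along axis [k]: it commutes with derivatives and makes a continuous function
    Lipschitz in coordinate [k]. *)
Definition avg (k : 'I_d) (delta : R) u x := mean (fun t => u (x + (delta * t) *: dir k)).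

Lemma continuous_line u x k (delta : R) : continuous u ->
  continuous (fun t : R => u (x + (delta * t) *: dir k)).
Proof.
move=> uc t; apply: (@continuous_comp _ _ _ (fun t : R => x + (delta * t) *: dir k) u).
  apply: continuousD; first exact: cst_continuous.
  apply: continuousZr_tmp; apply: continuousM; first exact: cst_continuous.
  exact: cvg_id.
exact: uc.
Qed.

Lemma avg_close k u (M e : R) : continuous u -> 0 < e ->
  exists2 r : R, 0 < r & forall delta x, 0 <= delta -> delta <= r -> `|x| <= M ->
    `|avg k delta u x - u x| <= e.
Proof.
move=> uc e0; have [r r0 hr] := uniform_continuous_cball M uc e0.
exists r => // delta x d0 dr xM; rewrite -[X in _ - X]mean_cst.
apply: mean_close; [exact: continuous_line|exact: cst_continuous|].
move=> t /andP[t0 t1]; apply: hr => //; rewrite addrAC subrr add0r.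
apply: (le_trans (norm_dir_le _ _)); rewrite ger0_norm ?mulr_ge0//.
by apply: le_trans dr; rewrite ler_piMr.
Qed.

Lemma norm_shift_le k (delta t : R) x : 0 <= delta <= 1 -> 0 <= t <= 1 ->
  `|x + (delta * t) *: dir k| <= `|x| + 1.
Proof.
move=> /andP[d0 d1] /andP[t0 t1].
apply: (le_trans (ler_normD _ _)); rewrite lerD2l (le_trans (norm_dir_le _ _))//.
by rewrite ger0_norm ?mulr_ge0// mulr_ile1.
Qed.

Lemma avg_continuous k delta u : 0 <= delta <= 1 -> continuous u ->
  continuous (avg k delta u).
Proof.
move=> d01 uc x; apply/continuous_epsP => e e0.
have [r r0 hr] := uniform_continuous_cball (`|x| + 1) uc e0.
exists r => // y yx; apply: mean_close; [exact: continuous_line..|].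
move=> t t01; apply: hr; first exact: norm_shift_le.
by rewrite opprD addrACA subrr addr0 ltW.
Qed.

(** Differentiation under the integral: strict differentiability gives one error bound for all [t],
    and the mean preserves it. *)
Lemma is_grad_avg k delta u g : 0 <= delta <= 1 -> is_grad u g ->
  is_grad (avg k delta u) (fun a => avg k delta (g a)).
Proof.
move=> d01 ug; have uc := is_grad_continuous ug.
split; last by move=> a; apply: avg_continuous => //; exact: ug.2.
move=> x; apply: is_diff_eps => e e0.
have [r r0 hr] := is_grad_strict (`|x| + 1) ug e0.
exists r => // y yr.
have cg a := @continuous_line (g a) x k delta (ug.2 a).
have cyg a : continuous (fun t : R => y 0 a * g a (x + (delta * t) *: dir k)).
  by move=> t; apply: continuousM; [exact: cst_continuous|exact: cg].
have cl := @continuous_line u x k delta uc.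
have csum : continuous (fun t : R => \sum_a y 0 a * g a (x + (delta * t) *: dir k)).
  exact: (@continuous_sum_seq R R _ (index_enum 'I_d)
    (fun a t => y 0 a * g a (x + (delta * t) *: dir k)) cyg).
have -> : avg k delta u x = mean (fun t => u (x + (delta * t) *: dir k)) by [].
have -> : \sum_a y 0 a * avg k delta (g a) x =
    mean (fun t => \sum_a y 0 a * g a (x + (delta * t) *: dir k)).
  by rewrite mean_sum//; apply: eq_bigr => a _; rewrite meanZ.
rewrite -addrA -opprD -meanD//.
apply: mean_close.
- exact: continuous_line.
- by move=> t; apply: (continuousD (cl t)); exact: csum.
move=> t t01; rewrite opprD addrA.
set x0 := x + _.
have -> : x + y + (delta * t) *: dir k = x0 + y by rewrite /x0 addrAC.
have := hr x0 x0 (x0 + y); rewrite subrr normr0.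
have -> : x0 + y - x0 = y by rewrite addrAC subrr add0r.
by apply => //; [exact: norm_shift_le|exact: ltW].
Qed.

Lemma is_grad2_avg k delta u g h : 0 <= delta <= 1 -> is_grad2 u g h ->
  is_grad2 (avg k delta u) (fun a => avg k delta (g a))
    (fun a b => avg k delta (h a b)).
Proof. by move=> d01 [ug gh]; split => [|a]; exact: is_grad_avg. Qed.

(** Lipschitz on bounded sets in the first [k] coordinates. For [k = 0] the two points coincide; for
    [k = d] this is the full local Lipschitz property. *)
Definition lip_in (k : nat) u : Prop :=
  forall M : R, exists2 C : R, 0 <= C & forall x y, `|x| <= M -> `|y| <= M ->
    (forall a : 'I_d, (k <= a)%N -> x 0 a = y 0 a) -> `|u x - u y| <= C * `|x - y|.

Lemma lip_in_avg k (delta : R) u : 0 < delta <= 1 -> continuous u -> lip_in k u ->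
  forall i : 'I_d, lip_in k (avg i delta u).
Proof.
move=> /andP[d0 d1] uc uL i M; have [C C0 hC] := uL (M + 1).
have d01 : 0 <= delta <= 1 by rewrite ltW.
exists C => // x y xM yM xy; apply: mean_close; [exact: continuous_line..|].
move=> t t01; apply: (le_trans (hC _ _ _ _ _)).
- by apply: (le_trans (norm_shift_le _ _ d01 t01)); rewrite lerD2r.
- by apply: (le_trans (norm_shift_le _ _ d01 t01)); rewrite lerD2r.
- by move=> a ka; rewrite mxE xy// [in RHS]mxE.
by rewrite opprD addrACA subrr addr0.
Qed.

Lemma avg_shift_bound (k : 'I_d) (delta : R) u (M : R) : 0 < delta <= 1 ->
  continuous u -> exists2 C : R, 0 <= C & forall x (s : R), `|x| <= M -> 0 <= s ->
    s <= 2 * M -> `|avg k delta u (x + s *: dir k) - avg k delta u x| <= C * s.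
Proof.
move=> /andP[d0 d1] uc.
(* The averages and their translates use points displaced from [x] by at most
   [delta + s <= 1 + 2 * M]. *)
have [C C0 hC] := continuous_bounded_cball (M + (1 + 2 * M)) uc.
exists (2 * C / delta); first by rewrite divr_ge0 ?mulr_ge0// ltW.
move=> x s xM s0 sM.
have := @mean_shift R (fun t => u (x + (delta * t) *: dir k)) (s / delta) C.
have -> : (fun t => u (x + (delta * (t + s / delta)) *: dir k)) =
    (fun t => u (x + s *: dir k + (delta * t) *: dir k)).
  apply/funext => t; congr (u _); rewrite -addrA -scalerDl; congr (_ + _ *: _).
  by field; rewrite gt_eqF.
have -> : 2 * C / delta * s = 2 * C * (s / delta) by field; rewrite gt_eqF.
apply; [exact: continuous_line|by rewrite divr_ge0// ltW|].
move=> t /andP[t0 ts]; apply: hC; apply: (le_trans (ler_normD _ _)); rewrite lerD//.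
apply: (le_trans (norm_dir_le _ _)); rewrite ger0_norm ?mulr_ge0 ?(ltW d0)//.
apply: (@le_trans _ _ (delta * (1 + s / delta))).
  by rewrite ler_wpM2l// ltW.
have -> : delta * (1 + s / delta) = delta + s by field; rewrite gt_eqF.
exact: lerD.
Qed.

(** The intermediate point [z] differs from [x] only in coordinate [k], where the average is
    Lipschitz, and from [y] only in earlier ones, where averaging preserves the old bound. For a
    negative step the roles of [x] and [z] are exchanged. *)
Lemma lip_in_avgS (k : 'I_d) (delta : R) u : 0 < delta <= 1 -> continuous u ->
  lip_in k u -> lip_in k.+1 (avg k delta u).
Proof.
move=> d01 uc uL M.
have [C1 C10 h1] := lip_in_avg d01 uc uL k M.
have [C2 C20 h2] := avg_shift_bound k M d01 uc.
exists (C1 + C2); first exact: addr_ge0.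
move=> x y xM yM xy.
pose z : 'rV[R]_d := \row_a (if a == k then y 0 a else x 0 a).
have zM : `|z| <= M.
  apply/rV_norm_le; first exact: le_trans (normr_ge0 _) xM.
  move=> a; rewrite mxE; case: ifP => _.
    exact: le_trans (rV_norm_coord _ _) yM.
  exact: le_trans (rV_norm_coord _ _) xM.
have zy : `|avg k delta u z - avg k delta u y| <= C1 * `|z - y|.
  apply: h1 => // a; rewrite leq_eqVlt => /predU1P[ka|ka].
    have -> : a = k by apply: val_inj; rewrite /= -ka.
    by rewrite mxE eqxx.
  by rewrite mxE; case: ifP => // _; exact: xy.
have zyxy : `|z - y| <= `|x - y|.
  apply/rV_norm_le => // a; rewrite !mxE; case: ifP => _; first by rewrite subrr normr0.
  have -> : x 0 a - y 0 a = (x - y) 0 a by rewrite !mxE.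
  exact: rV_norm_coord.
set s := y 0 k - x 0 k.
have zx : z = x + s *: dir k.
  apply/rowP => a; rewrite !mxE eqxx/=; case: eqVneq => [->|_].
    by rewrite mulr1 /s addrC subrK.
  by rewrite mulr0 addr0.
have sxy : `|s| <= `|x - y|.
  by rewrite /s distrC (_ : x 0 k - y 0 k = (x - y) 0 k) ?rV_norm_coord ?mxE.
have sM : `|s| <= 2 * M.
  apply: (le_trans sxy); apply: (le_trans (ler_normB _ _)); lra.
have xz : `|avg k delta u x - avg k delta u z| <= C2 * `|s|.
  have [s0|s0] := leP 0 s.
    by rewrite distrC zx (ger0_norm s0) h2//; move: sM; rewrite (ger0_norm s0).
  have -> : x = z + `|s| *: dir k.
    by rewrite zx (ltr0_norm s0) -addrA -scalerDl subrr scale0r addr0.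
  exact: h2.
rewrite -(subrK (avg k delta u z) (avg k delta u x)) -addrA.
apply: (le_trans (ler_normD _ _)); rewrite mulrDl [leRHS]addrC lerD//.
  by apply: (le_trans xz); rewrite ler_wpM2l.
by apply: (le_trans zy); rewrite ler_wpM2l.
Qed.

Lemma exists_common_radius (I : finType) (Q : I -> R -> Prop) :
  (forall i, exists2 r : R, 0 < r & forall s, 0 < s -> s <= r -> Q i s) ->
  exists2 r : R, 0 < r & forall s i, 0 < s -> s <= r -> Q i s.
Proof.
move=> h; pose rr i := sval (cid2 (h i)).
exists (\big[Num.min/1]_i rr i).
  by apply: lt_bigmin => // i _; rewrite /rr; case: cid2.
move=> s i s0 sr; have : s <= rr i by apply: (le_trans sr); exact: bigmin_le.
by rewrite /rr; case: cid2 => r /= _; apply.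
Qed.

(** One average per axis: each adds a coordinate to the Lipschitz property of the derivatives and
    takes half of the tolerance, leaving the other half to the earlier ones. *)
Lemma smoothing_step (k : nat) u g h (M e : R) : (k <= d)%N -> is_grad2 u g h -> 0 < e ->
  exists u' g' h', [/\ is_grad2 u' g' h',
    (forall x, `|x| <= M -> [/\ `|u' x - u x| <= e,
       (forall a, `|g' a x - g a x| <= e) &
       (forall a b, `|h' a b x - h a b x| <= e)]),
    (forall a, lip_in k (g' a)) & (forall a b, lip_in k (h' a b))].
Proof.
elim: k e => [|k IH] e kd ugh e0.
  exists u, g, h; split => //.
  - by move=> x _; split => *; rewrite subrr normr0 ltW.
  - move=> a N; exists 0 => // x y _ _ xy.
    have -> : x = y by apply/rowP => b; exact: xy.
    by rewrite !subrr !normr0 mulr0.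
  - move=> a b N; exists 0 => // x y _ _ xy.
    have -> : x = y by apply/rowP => c; exact: xy.
    by rewrite !subrr !normr0 mulr0.
have [u1 [g1 [h1 [gr1 cl1 Lg1 Lh1]]]] := IH _ (ltnW kd) ugh (half_gt0 e0).
pose kk := Ordinal kd.
have [uc gc hc] : [/\ continuous u1, (forall a, continuous (g1 a)) &
    forall a b, continuous (h1 a b)].
  split; first exact: is_grad_continuous gr1.1.
    by move=> a; exact: gr1.1.2.
  by move=> a b; exact: (gr1.2 a).2.
have close v : continuous v -> exists2 r : R, 0 < r & forall s, 0 < s -> s <= r ->
    forall x, `|x| <= M -> `|avg kk s v x - v x| <= e / 2.
  move=> vc; have [r r0 hr] := avg_close kk M vc (half_gt0 e0).
  by exists r => // s s0 sr x; apply: hr => //; exact: ltW.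
have [r1 r10 hr1] := close _ uc.
have [r2 r20 hr2] := exists_common_radius (fun a => close _ (gc a)).
have [r3 r30 hr3] := exists_common_radius
  (fun ab : 'I_d * 'I_d => close _ (hc ab.1 ab.2)).
pose s := Num.min 1 (Num.min r1 (Num.min r2 r3)).
have s0 : 0 < s by rewrite !lt_min ltr01 r10 r20 r30.
have s1 : s <= 1 by rewrite ge_min lexx.
have [sr1 sr2 sr3] : [/\ s <= r1, s <= r2 & s <= r3].
  by rewrite /s !ge_min !lexx !orbT.
have s01 : 0 <= s <= 1 by rewrite ltW.
have s01' : 0 < s <= 1 by rewrite s0.
exists (avg kk s u1), (fun a => avg kk s (g1 a)), (fun a b => avg kk s (h1 a b)).
split; first exact: is_grad2_avg.
- move=> x xM; have [c1 c2 c3] := cl1 x xM.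
  have tri (p q w : R) : `|p - q| <= e / 2 -> `|q - w| <= e / 2 -> `|p - w| <= e.
    move=> pq qw; rewrite -(subrK q p) -addrA (le_trans (ler_normD _ _))//.
    by rewrite (splitr e) lerD.
  split=> [|a|a b].
  + exact: tri (hr1 s s0 sr1 x xM) c1.
  + exact: tri (hr2 s a s0 sr2 x xM) (c2 a).
  + exact: tri (hr3 s (a, b) s0 sr3 x xM) (c3 a b).
- by move=> a; exact: (@lip_in_avgS kk).
- by move=> a b; exact: (@lip_in_avgS kk).
Qed.

End Averaging.

(** * Cutoff functions *)

Section Cutoff.
Variable R : realType.

Lemma is_derive_eps (phi : R -> R) (t D : R) :
  (forall e : R, 0 < e -> exists2 r : R, 0 < r & forall h, `|h| <= r ->
     `|phi (t + h) - phi t - h * D| <= e * `|h|) -> is_derive t (1 : R) phi D.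
Proof.
move=> H.
have C : (fun h : R => h^-1 *: (phi (h *: (1 : R) + t) - phi t)) @ (0 : R)^' --> D.
  apply/cvgrPdist_le => e e0; have [r r0 hr] := H e e0.
  exists r => // h /=; rewrite sub0r normrN => hlt h0.
  have := hr h (ltW hlt); rewrite /GRing.scale/= mulr1 [t + h]addrC => E.
  have -> : D - h^-1 * (phi (h + t) - phi t) =
      - h^-1 * (phi (h + t) - phi t - h * D) by field.
  rewrite normrM normrN normfV mulrC ler_pdivrMr ?normr_gt0//.
have dv : derivable phi t 1 by apply/cvg_ex; exists D.
split=> //; apply: cvg_lim => //; exact: norm_hausdorff.
Qed.

Definition pospart (t : R) : R := Num.max 0 t.

Lemma pospart_ge0 t : 0 <= t -> pospart t = t.
Proof. by move=> t0; rewrite /pospart; apply/max_idPr. Qed.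

Lemma pospart_le0 t : t <= 0 -> pospart t = 0.
Proof. by move=> t0; rewrite /pospart; apply/max_idPl. Qed.

(** The factor [6 * (_ / 2)] is the form in which the derivative of the cube is written in the next
    lemma, so the two chain. *)
Lemma is_derive_pospart_sq (t : R) :
  is_derive t (1 : R) (fun t => 6 * (pospart t ^+ 2 / 2)) (6 * pospart t).
Proof.
apply: is_derive_eps => e e0; exists (e / 3); first by rewrite divr_gt0.
move=> h he.
have K : `|6 * (pospart (t + h) ^+ 2 / 2) - 6 * (pospart t ^+ 2 / 2) - h * (6 * pospart t)|
    <= 3 * h ^+ 2.
  rewrite ler_norml.
  have [t0|t0] := leP 0 t; have [h0|h0] := leP 0 (t + h).
  - rewrite !pospart_ge0//; apply/andP; split; nra.
  - rewrite (pospart_ge0 t0) (pospart_le0 (ltW h0)); apply/andP; split; nra.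
  - rewrite (pospart_ge0 h0) (pospart_le0 (ltW t0)); apply/andP; split; nra.
  - rewrite (pospart_le0 (ltW h0)) (pospart_le0 (ltW t0)); apply/andP; split; nra.
apply: (le_trans K); rewrite -(real_normK (num_real h)) expr2 mulrA ler_wpM2r//.
by rewrite mulrC -ler_pdivlMr.
Qed.

Lemma is_derive_pospart_cube (t : R) :
  is_derive t (1 : R) (fun t => pospart t ^+ 3) (6 * (pospart t ^+ 2 / 2)).
Proof.
have c0 : 0 < 3 * `|t| + 1 by rewrite ltr_wpDl ?mulr_ge0.
(* For [|h| <= 1] the cubic part of the remainder is at most [h ^+ 2]. *)
apply: is_derive_eps => e e0; exists (Num.min 1 (e / (3 * `|t| + 1))).
  by rewrite lt_min ltr01 divr_gt0.
move=> h; rewrite le_min => /andP[h1 he].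
have K : `|pospart (t + h) ^+ 3 - pospart t ^+ 3 - h * (6 * (pospart t ^+ 2 / 2))|
    <= (3 * `|t| + 1) * h ^+ 2.
  move: h1; rewrite !ler_norml => /andP[h1 h2].
  have [t0|t0] := leP 0 t; have [h0|h0] := leP 0 (t + h).
  - rewrite !pospart_ge0// ger0_norm//.
    have -> : (t + h) ^+ 3 - t ^+ 3 - h * (6 * (t ^+ 2 / 2)) = (3 * t + h) * h ^+ 2 by field.
    have hh := sqr_ge0 h; apply/andP; split; nra.
  - rewrite (pospart_ge0 t0) (pospart_le0 (ltW h0)) ger0_norm//.
    have -> : 0 ^+ 3 - t ^+ 3 - h * (6 * (t ^+ 2 / 2)) = t ^+ 2 * (- t - 3 * h) by field.
    have a0 : 0 <= t ^+ 2 * (- t - 3 * h) by rewrite mulr_ge0 ?sqr_ge0//; lra.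
    have a1 : t * - h <= h ^+ 2 by nra.
    have a2 : t * (t * - h) <= t * h ^+ 2 by rewrite ler_wpM2l.
    have a3 : 0 <= t ^+ 3 by rewrite exprn_ge0.
    have a4 := sqr_ge0 h.
    have a5 : 0 <= t * h ^+ 2 by rewrite mulr_ge0.
    have -> : t ^+ 2 * (- t - 3 * h) = 3 * (t * (t * - h)) - t ^+ 3 by ring.
    have -> : (3 * t + 1) * h ^+ 2 = 3 * (t * h ^+ 2) + h ^+ 2 by ring.
    apply/andP; split; last lra.
    have -> : 3 * (t * (t * - h)) - t ^+ 3 = t ^+ 2 * (- t - 3 * h) by ring.
    lra.
  - rewrite (pospart_ge0 h0) (pospart_le0 (ltW t0)) ltr0_norm//.
    have -> : (t + h) ^+ 3 - 0 ^+ 3 - h * (6 * (0 ^+ 2 / 2)) = (t + h) ^+ 2 * (t + h) by field.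
    have a1 : (t + h) ^+ 2 <= h ^+ 2 by rewrite lerXn2r ?nnegrE//; lra.
    have a2 : (t + h) ^+ 2 * (t + h) <= h ^+ 2 * 1.
      by rewrite ler_pM ?sqr_ge0//; lra.
    have a3 : 0 <= (t + h) ^+ 2 * (t + h) by rewrite mulr_ge0 ?sqr_ge0.
    have a4 : 0 <= - t * h ^+ 2 by rewrite mulr_ge0 ?sqr_ge0//; lra.
    have -> : (3 * - t + 1) * h ^+ 2 = 3 * (- t * h ^+ 2) + h ^+ 2 by ring.
    have a5 := sqr_ge0 h.
    apply/andP; split; lra.
  - rewrite (pospart_le0 (ltW h0)) (pospart_le0 (ltW t0)) !expr0n/= mul0r !mulr0 !subr0.
    by rewrite oppr_le0 mulr_ge0 ?sqr_ge0 ?(ltW c0).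
apply: (le_trans K); rewrite -(real_normK (num_real h)) expr2 mulrA ler_wpM2r//.
by rewrite mulrC -ler_pdivlMr.
Qed.

Lemma pospart_continuous : continuous pospart.
Proof.
move=> t; apply/continuous_epsP => e e0; exists e => // s /ltW; apply: le_trans.
have [t0|t0] := leP 0 t; have [s0|s0] := leP 0 s; rewrite ?(pospart_ge0 t0)
  ?(pospart_ge0 s0) ?(pospart_le0 (ltW t0)) ?(pospart_le0 (ltW s0))//.
- by rewrite sub0r normrN ger0_norm// distrC ger0_norm; lra.
- by rewrite subr0 !ger0_norm; lra.
by rewrite subr0 normr0.
Qed.

(* For [s t = pospart t ^+ 3] this is the cumulative cubic B-spline, equal to 0
   for [t <= 0] and to 1 for [3 <= t]. *)
Definition diff3 (s : R -> R) (t : R) : R :=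
  (s t - 3 * s (t - 1) + 3 * s (t - 2) - s (t - 3)) / 6.

Lemma is_derive_diff3 (s s' : R -> R) (t : R) :
  (forall t : R, is_derive t (1 : R) s (s' t)) ->
  is_derive t (1 : R) (diff3 s) (diff3 s' t).
Proof.
move=> ds.
have sh (c : R) : is_derive t (1 : R) (fun t => s (t - c)) (s' (t - c)).
  have h1 : is_derive t (1 : R) (fun t : R => t - c) 1.
    by apply: is_derive_eq; rewrite subr0.
  have := @is_derive1_comp R s (fun t => t - c) t (s' (t - c)) 1 (ds (t - c)) h1.
  by rewrite mulr1 => H; exact: H.
have h := is_deriveB (is_deriveD (is_deriveB (ds t) (is_deriveZ 3 (sh 1)))
  (is_deriveZ 3 (sh 2))) (sh 3).
have := is_deriveZ (6^-1) h; congr (is_derive _ _ _ _).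
  by apply/funext => x; rewrite /diff3 mulrC.
by rewrite /diff3 mulrC.
Qed.

Lemma diff3_le0 s t : (forall t, t <= 0 -> s t = 0) -> t <= 0 -> diff3 s t = 0.
Proof.
by move=> s0 t0; rewrite /diff3 !s0; [rewrite !mulr0 !subr0 addr0 mul0r|lra..].
Qed.

Lemma diff3_continuous s : continuous s -> continuous (diff3 s).
Proof.
move=> sc t.
have sh (c : R) : {for t, continuous (fun t => s (t - c))}.
  apply: (@continuous_comp _ _ _ (fun t => t - c) s); last exact: sc.
  by apply: continuousB; [exact: cvg_id|exact: cst_continuous].
have c (r : R) : {for t, continuous (fun _ : R => r)} by exact: cst_continuous.
exact: (continuousM (continuousB (continuousD (continuousB (sc t)
  (continuousM (c 3) (sh 1))) (continuousM (c 3) (sh 2))) (sh 3)) (c 6^-1)).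
Qed.

Variable d : nat.

Lemma is_grad2_cst (c : R) : is_grad2 (cst c : 'rV[R]_d -> R) (fun _ => cst 0) (fun _ _ => cst 0).
Proof. by split=> [|a]; exact: is_grad_cst. Qed.

Lemma is_grad2_coord (a : 'I_d) : is_grad2 (fun x : 'rV[R]_d => x 0 a)
  (fun b => cst (b == a)%:R) (fun _ _ => cst 0).
Proof. by split=> [|b]; [exact: is_grad_coord|exact: is_grad_cst]. Qed.

Lemma is_grad2_sum (I : Type) (r : seq I) (U : I -> 'rV[R]_d -> R) G H :
  (forall i, is_grad2 (U i) (G i) (H i)) ->
  is_grad2 (fun x => \sum_(i <- r) U i x) (fun a x => \sum_(i <- r) G i a x)
    (fun a b x => \sum_(i <- r) H i a b x).
Proof.
move=> UGH; split=> [|a]; first by apply: is_grad_sum => i; have [] := UGH i.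
exact: (is_grad_sum r (fun i => (UGH i).2 a)).
Qed.

Lemma is_grad2_comp (s s' s'' : R -> R) (u : 'rV[R]_d -> R) g h :
  (forall t : R, is_derive t (1 : R) s (s' t)) ->
  (forall t : R, is_derive t (1 : R) s' (s'' t)) -> continuous s'' ->
  is_grad2 u g h ->
  is_grad2 (s \o u) (fun a x => s' (u x) * g a x)
    (fun a b x => s' (u x) * h a b x + g a x * (s'' (u x) * g b x)).
Proof.
move=> d1 d2 c2 [ug gh]; split.
  apply: is_grad_comp => // t; apply: differentiable_continuous.
  by apply/derivable1_diffP; have [] := d2 t.
by move=> a; exact: (is_gradM (is_grad_comp d2 c2 ug) (gh a)).
Qed.

Lemma exists_cutoff (M : R) : exists chi g h, exists M' : R,
  [/\ is_grad2 (chi : 'rV[R]_d -> R) g h,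
    (forall x, `|x| <= M -> [/\ chi x = 1, forall a, g a x = 0 & forall a b, h a b x = 0]) &
    (forall x, M' < `|x| -> [/\ chi x = 0, forall a, g a x = 0 & forall a b, h a b x = 0])].
Proof.
pose s3 (t : R) := pospart t ^+ 3.
pose s2 (t : R) := 6 * (pospart t ^+ 2 / 2).
pose s1 (t : R) := 6 * pospart t.
have s1c : continuous s1.
  move=> t; exact: (continuousM (@cst_continuous R R 6 t) (@pospart_continuous t)).
have d3 t : is_derive t (1 : R) (diff3 s3) (diff3 s2 t).
  by apply: is_derive_diff3 => t'; exact: is_derive_pospart_cube.
have d2 t : is_derive t (1 : R) (diff3 s2) (diff3 s1 t).
  by apply: is_derive_diff3 => t'; exact: is_derive_pospart_sq.
(* The maximum norm is not smooth, so the cutoff is a function of the squared Euclidean norm [q],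
   which is at most [N] on the ball of radius [M]. The spline ends at 3, and [|x| > N + 3] forces
   [q x >= N + 3]. *)
pose N := d%:R * M ^+ 2.
have N0 : 0 <= N by rewrite mulr_ge0 ?sqr_ge0.
pose q (x : 'rV[R]_d) := \sum_a x 0 a * x 0 a.
have gq := is_grad2B (is_grad2_sum (index_enum 'I_d)
  (fun a => is_grad2M (is_grad2_coord a) (is_grad2_coord a))) (is_grad2_cst N).
have gchi := is_grad2B (is_grad2_cst 1) (is_grad2_comp d3 d2 (diff3_continuous s1c) gq).
have [low high] : (forall x, `|x| <= M -> q x - N <= 0) /\
    (forall x, N + 3 < `|x| -> 3 <= q x - N).
  split=> x xM.
    rewrite subr_le0; apply: (@le_trans _ _ (\sum_(a < d) M ^+ 2)).
      apply: ler_sum => a _; rewrite -expr2 -(real_normK (num_real (x 0 a))).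
      have xaM : `|x 0 a| <= M by apply: le_trans xM; exact: rV_norm_coord.
      by rewrite lerXn2r// nnegrE; exact: le_trans xaM.
    by rewrite sumr_const card_ord -[leLHS]mulr_natl.
  have q0 : 0 <= q x by apply: sumr_ge0 => a _; rewrite -expr2 sqr_ge0.
  have xq : `|x| <= Num.sqrt (q x).
    apply/rV_norm_le => // a; rewrite -(sqrtr_sqr (x 0 a)) ler_sqrt//.
    rewrite /q (bigD1 a)//= expr2 lerDl sumr_ge0// => b _.
    by rewrite -expr2 sqr_ge0.
  have : `|x| ^+ 2 <= q x.
    by rewrite -(sqr_sqrtr q0) lerXn2r ?nnegrE ?sqrtr_ge0.
  by nra.
have lo3 t : t <= 0 -> s3 t = 0 by move=> t0; rewrite /s3 pospart_le0// expr0n.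
have lo2 t : t <= 0 -> s2 t = 0.
  by move=> t0; rewrite /s2 pospart_le0// expr0n mul0r mulr0.
have lo1 t : t <= 0 -> s1 t = 0 by move=> t0; rewrite /s1 pospart_le0// mulr0.
have hi3 t : 3 <= t -> diff3 s3 t = 1.
  by move=> t3; rewrite /diff3 /s3 !pospart_ge0; [field|lra..].
have hi2 t : 3 <= t -> diff3 s2 t = 0.
  by move=> t3; rewrite /diff3 /s2 !pospart_ge0; [field|lra..].
have hi1 t : 3 <= t -> diff3 s1 t = 0.
  by move=> t3; rewrite /diff3 /s1 !pospart_ge0; [field|lra..].
(* The cutoff and its derivatives are read off from [gchi]. *)
do 3 eexists; exists (N + 3); split; first exact: gchi.
  move=> x /low qx; split=> [|a|a b] /=; rewrite -/(q x) ?(diff3_le0 lo3)//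
    ?(diff3_le0 lo2)// ?(diff3_le0 lo1)// ?subr0// !mul0r ?mulr0 ?addr0 subr0//.
move=> x /high qx; split=> [|a|a b] /=; rewrite -/(q x) ?hi3// ?hi2// ?hi1//
  ?subrr// !mul0r ?mulr0 ?addr0 subr0//.
Qed.

End Cutoff.

(** * Quadratic perturbations *)

Lemma ler_norm_sum_ord (R : realType) n (P : pred 'I_n) (F : 'I_n -> R) (e : R) :
  0 <= e -> (forall i, P i -> `|F i| <= e) ->
  `|\sum_(i < n | P i) F i| <= n%:R * e.
Proof. by move=> e0 h; rewrite -[X in X%:R](card_ord n); exact: ler_norm_sum_cst. Qed.

Section QuadraticPerturbation.
Variables (R : realType) (d m : nat) (j : 'I_m) (l : 'I_d).
Implicit Types (P : 'I_m -> 'I_d -> R) (H : 'I_m -> 'I_d -> 'I_d -> R)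
  (x v : 'rV[R]_d) (w : 'rV[R]_m) (al : 'I_m -> R) (be ga : 'I_d -> R).

(** The parameters match the equations: [ga] shifts [w *m Df], [al i] shifts entry [i] of [Df v] for
    [i] other than [j], and [be] shifts the equations with second derivatives. *)
Definition quad al be ga (i : 'I_m) x : R :=
  if i == j then \sum_a x 0 a * ga a + x 0 l * \sum_b x 0 b * be b else al i * x 0 l.

Definition quad_grad al be ga (i : 'I_m) (a : 'I_d) x : R :=
  if i == j then ga a + (x 0 l * be a + (\sum_b x 0 b * be b) * (a == l)%:R)
  else al i * (a == l)%:R.

Definition quad_hess be (i : 'I_m) (a b : 'I_d) x : R :=
  if i == j then (b == l)%:R * be a + be b * (a == l)%:R else 0.

Lemma is_grad2_linear ga :
  is_grad2 (fun x => \sum_a x 0 a * ga a) (fun a => cst (ga a)) (fun _ _ => cst 0).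
Proof.
split=> [|a]; last exact: is_grad_cst.
have := is_grad_sum (index_enum 'I_d)
  (fun a => is_gradM (is_grad_coord R a) (is_grad_cst d (ga a))).
congr is_grad; apply/funext => a; apply/funext => x /=.
rewrite (bigD1 a)//= eqxx mulr1 mulr0 add0r big1 ?addr0// => b ba.
by rewrite eq_sym (negbTE ba) !mulr0 addr0.
Qed.

Lemma is_grad2_quad al be ga i :
  is_grad2 (quad al be ga i) (quad_grad al be ga i) (quad_hess be i).
Proof.
have [ij|ij] := eqVneq i j; last first.
  have := is_grad2M (is_grad2_cst d (al i)) (is_grad2_coord R l).
  rewrite /quad /quad_grad /quad_hess (negbTE ij); congr is_grad2.
    by apply/funext => a; apply/funext => x /=; rewrite mulr0 addr0.
  apply/funext => a; apply/funext => b; apply/funext => x /=.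
  by rewrite !mulr0 mul0r !addr0.
have := is_grad2D (is_grad2_linear ga) (is_grad2M (is_grad2_coord R l) (is_grad2_linear be)).
rewrite /quad /quad_grad /quad_hess ij eqxx; congr is_grad2.
apply/funext => a; apply/funext => b; apply/funext => x /=.
by rewrite !mulr0 !add0r mulrC [X in _ + X]mulrC.
Qed.

Lemma quad_small (M e : R) : 0 <= M -> 0 < e -> exists2 n : R, 0 < n &
  forall al be ga, (forall i, `|al i| <= n) -> (forall b, `|be b| <= n) ->
    (forall a, `|ga a| <= n) -> forall i x, `|x| <= M ->
    [/\ `|quad al be ga i x| <= e, forall a, `|quad_grad al be ga i a x| <= e &
        forall a b, `|quad_hess be i a b x| <= e].
Proof.
move=> M0 e0.
pose K := 2 + M + d%:R * M + M * (d%:R * M) + d%:R * M.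
have dM0 : 0 <= d%:R * M by rewrite mulr_ge0.
have MdM0 : 0 <= M * (d%:R * M) by rewrite mulr_ge0.
have K0 : 0 < K by rewrite /K; lra.
exists (e / K); first by rewrite divr_gt0.
set n := e / K; have n0 : 0 < n by rewrite divr_gt0.
have Kn : K * n = e by rewrite /n mulrC divfK// gt_eqF.
move=> al be ga aln ben gan i x xM.
have xaM a : `|x 0 a| <= M by apply: le_trans xM; exact: rV_norm_coord.
have lin (c : 'I_d -> R) : (forall a, `|c a| <= n) ->
    `|\sum_a x 0 a * c a| <= d%:R * M * n.
  move=> cn; rewrite -mulrA; apply: ler_norm_sum_ord.
    by rewrite mulr_ge0// ltW.
  by move=> a _; rewrite normrM ler_pM.
have delta (a : 'I_d) (t B : R) : 0 <= B -> `|t| <= B -> `|t * (a == l)%:R| <= B.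
  by move=> B0 tB; case: eqP => _; rewrite ?mulr1// mulr0 normr0.
have Mn0 : 0 <= M * n by rewrite mulr_ge0// ltW.
have dMn0 : 0 <= d%:R * M * n by rewrite mulr_ge0// ltW.
have MdMn0 : 0 <= M * (d%:R * M * n) by rewrite mulr_ge0.
have KE : K * n = n + n + M * n + d%:R * M * n + M * (d%:R * M * n) + d%:R * M * n.
  by rewrite /K; ring.
have xl : `|al i * x 0 l| <= M * n by rewrite mulrC normrM ler_pM.
rewrite -Kn KE /quad /quad_grad /quad_hess; split=> [|a|a b].
- case: ifP => _; last by lra.
  apply: (le_trans (ler_normD _ _)).
  have h1 := lin _ gan.
  have h2 : `|x 0 l * \sum_b x 0 b * be b| <= M * (d%:R * M * n).
    by rewrite normrM ler_pM// lin.
  lra.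
- case: ifP => _; last first.
    apply: (le_trans (delta a _ n (ltW n0) (aln i))); lra.
  apply: (le_trans (ler_normD _ _)).
  have h1 := gan a.
  have h2 : `|x 0 l * be a| <= M * n by rewrite normrM ler_pM.
  have h3 := delta a _ _ dMn0 (lin _ ben).
  have := ler_normD (x 0 l * be a) ((\sum_b x 0 b * be b) * (a == l)%:R).
  lra.
- case: ifP => _; last by rewrite normr0; lra.
  have h1 := delta b _ _ (ltW n0) (ben a).
  have h2 := delta a _ _ (ltW n0) (ben b).
  have := ler_normD ((b == l)%:R * be a) (be b * (a == l)%:R).
  rewrite [(b == l)%:R * _]mulrC; lra.
Qed.

(* The equations of [degenerate 0] for the perturbed map, solved for the
   parameters; they are triangular because [w 0 j = v 0 l = 1]. *)
Definition bad_al P v i : R := - \sum_a P i a * v 0 a.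
Definition bad_rhs H w v b : R := \sum_i \sum_a w 0 i * v 0 a * H i a b.
Definition bad_be H w v b : R :=
  - bad_rhs H w v b + (b == l)%:R * (2^-1 * \sum_a v 0 a * bad_rhs H w v a).
Definition bad_ga P H x w v a : R :=
  - (\sum_i w 0 i * P i a + (a == l)%:R * (\sum_(i | i != j) w 0 i * bad_al P v i)
     + x 0 l * bad_be H w v a + (a == l)%:R * \sum_b x 0 b * bad_be H w v b).

Lemma sum_delta (F : 'I_d -> R) : \sum_a F a * (a == l)%:R = F l.
Proof.
rewrite (bigD1 l)//= eqxx mulr1 big1 ?addr0// => a al.
by rewrite (negbTE al) mulr0.
Qed.

(** Back substitution with residuals of size [c]: [al] is off by at most [c], [be] by
    [(1 + d * M) * c], and [ga] inherits both errors. [K] adds these up. *)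
Lemma degenerate_bad_params (M c : R) P H al be ga x w v : 0 <= M -> 0 <= c ->
  `|x| <= M -> `|w| <= M -> w 0 j = 1 -> `|v| <= M -> v 0 l = 1 ->
  degenerate c (fun i a => P i a + quad_grad al be ga i a x)
    (fun i a b => H i a b + quad_hess be i a b x) w v ->
  let K := 1 + m%:R * M + (1 + M + d%:R * M) * (1 + d%:R * M) in
  [/\ forall i, i != j -> `|bad_al P v i - al i| <= K * c,
      forall b, `|bad_be H w v b - be b| <= K * c &
      forall a, `|bad_ga P H x w v a - ga a| <= K * c].
Proof.
move=> M0 c0 xM wM wj vM vl [E0 E1 E2] K.
have xaM a : `|x 0 a| <= M by apply: le_trans xM; exact: rV_norm_coord.
have vaM a : `|v 0 a| <= M by apply: le_trans vM; exact: rV_norm_coord.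
have wiM i : `|w 0 i| <= M by apply: le_trans wM; exact: rV_norm_coord.
have dM0 : 0 <= d%:R * M by rewrite mulr_ge0.
have mM0 : 0 <= m%:R * M by rewrite mulr_ge0.
have r1 i : i != j -> `|bad_al P v i - al i| <= c.
  move=> ij; rewrite distrC /bad_al opprK; apply: le_trans (E1 i).
  rewrite le_eqVlt; apply/orP; left; apply/eqP; congr (`|_|).
  rewrite /quad_grad (negbTE ij) addrC; under [RHS]eq_bigr do rewrite mulrDl.
  rewrite big_split/=; congr (_ + _).
  under eq_bigr do rewrite mulrAC; by rewrite sum_delta vl mulr1.
pose S := \sum_a v 0 a * be a.
pose ee b := bad_rhs H w v b + ((b == l)%:R * S + be b).
have ec b : `|ee b| <= c.
  apply: le_trans (E2 b); rewrite le_eqVlt; apply/orP; left; apply/eqP; congr (`|_|).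
  rewrite /ee /bad_rhs; under [RHS]eq_bigr do
    (under eq_bigr do rewrite mulrDr; rewrite big_split/=).
  rewrite big_split/=; congr (_ + _).
  rewrite (bigD1 j)//= [X in _ = _ + X]big1 ?addr0; last first.
    by move=> i ij; rewrite big1// => a _; rewrite /quad_hess (negbTE ij) mulr0.
  rewrite /quad_hess eqxx wj.
  under eq_bigr do rewrite mul1r mulrDr; rewrite big_split/=; congr (_ + _).
    by rewrite /S mulr_sumr; apply: eq_bigr => a _; ring.
  under eq_bigr do rewrite mulrA; by rewrite sum_delta vl mul1r.
(* Pairing the equations for [be] with [v], where [v l = 1], counts [S] twice; this is the origin of
   [2^-1] in [bad_be]. *)
have SE : S = 2^-1 * (\sum_a v 0 a * ee a - \sum_a v 0 a * bad_rhs H w v a).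
  have -> : \sum_a v 0 a * ee a =
      \sum_a v 0 a * bad_rhs H w v a + (S + S).
    under eq_bigr do rewrite /ee !mulrDr; rewrite !big_split/=; congr (_ + (_ + _)).
    under eq_bigr do rewrite mulrCA mulrC; by rewrite sum_delta vl mul1r.
  by field.
have r2 b : `|bad_be H w v b - be b| <= (1 + d%:R * M) * c.
  have -> : bad_be H w v b - be b =
      - (ee b - (b == l)%:R * (2^-1 * \sum_a v 0 a * ee a)).
    have eb : ee b = bad_rhs H w v b + ((b == l)%:R * S + be b) by [].
    rewrite eb SE /bad_be; set T1 := \sum_a v 0 a * ee a.
    set T2 := \sum_a v 0 a * bad_rhs H w v a; ring.
  rewrite normrN; apply: (le_trans (ler_normB _ _)); rewrite mulrDl mul1r lerD//.
  have h : `|\sum_a v 0 a * ee a| <= d%:R * M * c.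
    rewrite -mulrA; apply: ler_norm_sum_ord; first by rewrite mulr_ge0.
    by move=> a _; rewrite normrM ler_pM.
  have dMc : 0 <= d%:R * M * c by rewrite mulr_ge0.
  case: (b == l); last by rewrite mul0r normr0.
  rewrite mul1r normrM ger0_norm//; lra.
pose rho := (1 + d%:R * M) * c.
have rho0 : 0 <= rho by rewrite mulr_ge0// addr_ge0.
have KE : K * c = c + m%:R * M * c + rho + M * rho + d%:R * M * rho.
  by rewrite /K /rho; ring.
have [t1 t2 t3] : [/\ 0 <= m%:R * M * c, 0 <= M * rho & 0 <= d%:R * M * rho].
  by split; rewrite mulr_ge0.
split=> [i ij|b|a].
- by apply: (le_trans (r1 i ij)); rewrite KE; lra.
- by apply: (le_trans (r2 b)); rewrite KE -/rho; lra.
have Ea : \sum_i w 0 i * (P i a + quad_grad al be ga i a x) =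
    \sum_i w 0 i * P i a + (a == l)%:R * (\sum_(i | i != j) w 0 i * al i)
    + ga a + x 0 l * be a + (a == l)%:R * \sum_b x 0 b * be b.
  under eq_bigr do rewrite mulrDr; rewrite big_split/= -!addrA; congr (_ + _).
  rewrite (bigD1 j)//= {1}/quad_grad eqxx wj mul1r addrC; congr (_ + _).
    rewrite mulr_sumr; apply: eq_bigr => i ij; rewrite /quad_grad (negbTE ij); ring.
  by rewrite [X in _ + (_ + X)]mulrC.
have := E0 a; rewrite Ea => {}E0.
set e0 := (X in `|X| <= c) in E0.
have -> : bad_ga P H x w v a - ga a = - (e0
   + (a == l)%:R * (\sum_(i | i != j) w 0 i * (bad_al P v i - al i))
   + x 0 l * (bad_be H w v a - be a)
   + (a == l)%:R * \sum_b x 0 b * (bad_be H w v b - be b)).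
  have -> : \sum_(i | i != j) w 0 i * (bad_al P v i - al i) =
     \sum_(i | i != j) w 0 i * bad_al P v i - \sum_(i | i != j) w 0 i * al i.
    by rewrite -sumrB; apply: eq_bigr => i _; rewrite mulrBr.
  have -> : \sum_b x 0 b * (bad_be H w v b - be b) =
     \sum_b x 0 b * bad_be H w v b - \sum_b x 0 b * be b.
    by rewrite -sumrB; apply: eq_bigr => i _; rewrite mulrBr.
  by rewrite /e0 /bad_ga; ring.
rewrite normrN KE.
have delta (t B : R) : 0 <= B -> `|t| <= B -> `|(a == l)%:R * t| <= B.
  by move=> B0 tB; case: (a == l); rewrite ?mul1r// mul0r normr0.
have s1 : `|(a == l)%:R * (\sum_(i | i != j) w 0 i * (bad_al P v i - al i))| <= m%:R * M * c.
  apply: delta => //; rewrite -mulrA.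
  apply: ler_norm_sum_ord; first by rewrite mulr_ge0.
  by move=> i ij; rewrite normrM ler_pM// r1.
have s2 : `|x 0 l * (bad_be H w v a - be a)| <= M * rho by rewrite normrM ler_pM// r2.
have s3 : `|(a == l)%:R * \sum_b x 0 b * (bad_be H w v b - be b)| <= d%:R * M * rho.
  apply: delta => //; rewrite -mulrA.
  apply: ler_norm_sum_ord; first by rewrite mulr_ge0.
  by move=> b _; rewrite normrM ler_pM// r2.
apply: (le_trans (ler_normD _ _)).
have := ler_normD e0 ((a == l)%:R * (\sum_(i | i != j) w 0 i * (bad_al P v i - al i))).
have := ler_normD (e0 + (a == l)%:R * (\sum_(i | i != j) w 0 i * (bad_al P v i - al i)))
  (x 0 l * (bad_be H w v a - be a)).
lra.
Qed.

End QuadraticPerturbation.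

Section BoundedLipschitz.
Variables (R : realType) (S : Type) (close : R -> S -> S -> Prop).
Hypothesis close_ge0 : forall r s s', close r s s' -> 0 <= r.

(** Boundedness is included because it makes the class stable under products; the bad parameters are
    polynomials in such functions. *)
Definition bdd_lip (u : S -> R) : Prop := exists2 C : R, 0 <= C &
  (forall s, `|u s| <= C) /\ (forall r s s', close r s s' -> `|u s - u s'| <= C * r).

Lemma bdd_lip_cst (c : R) : bdd_lip (fun _ => c).
Proof.
exists `|c| => //; split => // r s s' /close_ge0 r0.
by rewrite subrr normr0 mulr_ge0.
Qed.

Lemma bdd_lipD u v : bdd_lip u -> bdd_lip v -> bdd_lip (fun s => u s + v s).
Proof.
move=> [C C0 [uC uL]] [D D0 [vD vL]]; exists (C + D); first exact: addr_ge0.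
split=> [s|r s s' ss]; first by rewrite (le_trans (ler_normD _ _))// lerD.
rewrite opprD addrACA mulrDl (le_trans (ler_normD _ _))// lerD//.
  exact: uL.
exact: vL.
Qed.

Lemma bdd_lipM u v : bdd_lip u -> bdd_lip v -> bdd_lip (fun s => u s * v s).
Proof.
move=> [C C0 [uC uL]] [D D0 [vD vL]]; exists (2 * (C * D)); first by rewrite !mulr_ge0.
have CD0 : 0 <= C * D by exact: mulr_ge0.
split=> [s|r s s' ss].
  have : `|u s * v s| <= C * D by rewrite normrM ler_pM.
  lra.
have -> : u s * v s - u s' * v s' = u s * (v s - v s') + (u s - u s') * v s' by ring.
have h1 : `|u s * (v s - v s')| <= C * (D * r) by rewrite normrM ler_pM// vL.
have h2 : `|(u s - u s') * v s'| <= C * r * D by rewrite normrM ler_pM// uL.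
apply: (le_trans (ler_normD _ _)).
have -> : 2 * (C * D) * r = C * (D * r) + C * r * D by ring.
exact: lerD.
Qed.

Lemma bdd_lipN u : bdd_lip u -> bdd_lip (fun s => - u s).
Proof.
move=> hu; rewrite (_ : (fun s => _) = (fun s => -1 * u s)).
  exact: (bdd_lipM (bdd_lip_cst (-1)) hu).
by apply/funext => s; rewrite mulN1r.
Qed.

Lemma bdd_lip_sum (I : Type) (r : seq I) (P : pred I) (F : I -> S -> R) :
  (forall i, P i -> bdd_lip (F i)) -> bdd_lip (fun s => \sum_(i <- r | P i) F i s).
Proof.
move=> hF; elim: r => [|i r IH].
  rewrite (_ : (fun s => _) = (fun _ => 0)); first exact: bdd_lip_cst.
  by apply/funext => s; rewrite big_nil.
have [Pi|Pi] := boolP (P i).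
  rewrite (_ : (fun s => _) = (fun s => F i s + \sum_(i <- r | P i) F i s)).
    exact: (bdd_lipD (hF i Pi) IH).
  by apply/funext => s; rewrite big_cons Pi.
rewrite (_ : (fun s => _) = (fun s => \sum_(i <- r | P i) F i s))//.
by apply/funext => s; rewrite big_cons (negbTE Pi).
Qed.

Lemma bdd_lip_uniform (J : finType) (B : pred J) (T : S -> J -> R) :
  (forall k, B k -> bdd_lip (T^~ k)) ->
  exists C : R, forall s s' r, close r s s' -> forall k, B k -> `|T s k - T s' k| <= C * r.
Proof.
move=> hT.
pose C k := if pselect (B k) is left h then sval (cid2 (hT k h)) else 0.
have C0 k : 0 <= C k by rewrite /C; case: pselect => // h; case: cid2.
exists (\sum_k C k) => s s' r ss k Bk.
apply: (@le_trans _ _ (C k * r)).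
  by rewrite /C; case: pselect => // h; case: cid2 => /= c _ [_]; apply.
rewrite ler_wpM2r ?(close_ge0 ss)// (bigD1 k)//= lerDl sumr_ge0//.
Qed.

End BoundedLipschitz.

(** * Openness and density of regularity *)

Section Density.
Variables (R : realType) (d m : nat) (j : 'I_m) (l : 'I_d).

Let D1 (f : 'rV[R]_d -> 'rV[R]_m) i a (x : 'rV[R]_d) : R := Df f x i a.
Let D2 (f : 'rV[R]_d -> 'rV[R]_m) i a b (x : 'rV[R]_d) : R :=
  D2f f x (mxvec_index i a) b.

(** The bad parameters are a Lipschitz function of the triple [(x, w, v)], since they are polynomial
    in its entries and in the Lipschitz functions [P] and [H]; pigeonhole then finds parameters away
    from all of them. *)
Lemma exists_regular_params (P : 'I_m -> 'I_d -> 'rV[R]_d -> R)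
    (H : 'I_m -> 'I_d -> 'I_d -> 'rV[R]_d -> R) (M n : R) : 1 <= M -> 0 < n ->
  (forall i a, continuous (P i a)) -> (forall i a b, continuous (H i a b)) ->
  (forall i a, lip_in d (P i a)) -> (forall i a b, lip_in d (H i a b)) ->
  exists al be ga, [/\ forall i, `|al i| <= n, forall b, `|be b| <= n,
    forall a, `|ga a| <= n &
    regular_on (fun i a x => P i a x + quad_grad j l al be ga i a x)
      (fun i a b x => H i a b x + quad_hess j l be i a b x) M j l].
Proof.
move=> M1 n0 Pc Hc PL HL.
have M0 : 0 <= M by exact: le_trans M1.
pose S := {s : 'rV[R]_d * 'rV[R]_m * 'rV[R]_d | [/\ `|s.1.1| <= M, `|s.1.2| <= M,
  s.1.2 0 j = 1, `|s.2| <= M & s.2 0 l = 1]}.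
pose X (s : S) := (sval s).1.1; pose W (s : S) := (sval s).1.2; pose V (s : S) := (sval s).2.
pose pi (s : S) (k : 'I_d + 'I_m + 'I_d) : R := match k with
  | inl (inl a) => X s 0 a | inl (inr i) => W s 0 i | inr a => V s 0 a end.
(* The entries [w j] and [v l] are fixed to 1 and index [j] is left out for [al], so that
   [2 * d + m - 2] variables face [2 * d + m - 1] parameters. *)
pose A : {set 'I_d + 'I_m + 'I_d} := ~: [set inl (inr j); inr l].
pose B : {set 'I_d + 'I_d + 'I_m} := ~: [set inr j].
pose close r s s' := forall k, k \in A -> `|pi s k - pi s' k| <= r.
have cX r s s' a : close r s s' -> `|X s 0 a - X s' 0 a| <= r.
  by move=> ss; apply: (ss (inl (inl a))); rewrite !inE.
have close_ge0 r s s' : close r s s' -> 0 <= r.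
  by move=> ss; apply: le_trans (cX _ _ _ l ss).
have cW r s s' i : close r s s' -> `|W s 0 i - W s' 0 i| <= r.
  move=> ss; have [->|ij] := eqVneq i j.
    have [_ _ h _ _] := svalP s; have [_ _ h' _ _] := svalP s'.
    rewrite /W h h' subrr normr0; exact: close_ge0 ss.
  by apply: (ss (inl (inr i))); rewrite !inE negb_or andbT; apply: contra ij => /eqP[->].
have cV r s s' a : close r s s' -> `|V s 0 a - V s' 0 a| <= r.
  move=> ss; have [->|al] := eqVneq a l.
    have [_ _ _ _ h] := svalP s; have [_ _ _ _ h'] := svalP s'.
    rewrite /V h h' subrr normr0; exact: close_ge0 ss.
  by apply: (ss (inr a)); rewrite !inE/=; apply: contra al => /eqP[->].
have XM s : `|X s| <= M by have [] := svalP s.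
have WM s : `|W s| <= M by have [] := svalP s.
have VM s : `|V s| <= M by have [] := svalP s.
have bX a : bdd_lip close (fun s => X s 0 a).
  exists (M + 1); first by rewrite addr_ge0.
  split=> [s|r s s' ss].
    by rewrite (le_trans (rV_norm_coord _ _))// (le_trans (XM s))// lerDl.
  by rewrite (le_trans (cX _ _ _ _ ss))// ler_peMl ?(close_ge0 _ _ _ ss)// lerDr.
have bW i : bdd_lip close (fun s => W s 0 i).
  exists (M + 1); first by rewrite addr_ge0.
  split=> [s|r s s' ss].
    by rewrite (le_trans (rV_norm_coord _ _))// (le_trans (WM s))// lerDl.
  by rewrite (le_trans (cW _ _ _ _ ss))// ler_peMl ?(close_ge0 _ _ _ ss)// lerDr.
have bV a : bdd_lip close (fun s => V s 0 a).
  exists (M + 1); first by rewrite addr_ge0.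
  split=> [s|r s s' ss].
    by rewrite (le_trans (rV_norm_coord _ _))// (le_trans (VM s))// lerDl.
  by rewrite (le_trans (cV _ _ _ _ ss))// ler_peMl ?(close_ge0 _ _ _ ss)// lerDr.
have bF (F : 'rV[R]_d -> R) : continuous F -> lip_in d F -> bdd_lip close (fun s => F (X s)).
  move=> Fc FL; have [C C0 hC] := FL M; have [C' C'0 hC'] := continuous_bounded_cball M Fc.
  exists (C + C'); first exact: addr_ge0.
  split=> [s|r s s' ss].
    by rewrite (le_trans (hC' _ (XM s)))// lerDr.
  apply: (@le_trans _ _ (C * `|X s - X s'|)).
    by apply: hC => // a; rewrite leqNgt ltn_ord.
  have r0 := close_ge0 _ _ _ ss.
  apply: ler_pM => //; first by rewrite lerDl.
  by apply/rV_norm_le => // a; rewrite mx_subE; exact: cX.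
have bP i a := bF _ (Pc i a) (PL i a).
have bH i a b := bF _ (Hc i a b) (HL i a b).
pose Ps s i a := P i a (X s); pose Hs s i a b := H i a b (X s).
have bal i : bdd_lip close (fun s => bad_al (Ps s) (V s) i).
  apply: bdd_lipN => //; apply: bdd_lip_sum => // a _.
  exact: (bdd_lipM (bP i a) (bV a)).
have brhs b : bdd_lip close (fun s => bad_rhs (Hs s) (W s) (V s) b).
  apply: bdd_lip_sum => // i _; apply: bdd_lip_sum => // a _.
  exact: (bdd_lipM (bdd_lipM (bW i) (bV a)) (bH i a b)).
have bbe b : bdd_lip close (fun s => bad_be l (Hs s) (W s) (V s) b).
  apply: bdd_lipD; first by apply: bdd_lipN => //; exact: brhs.
  apply: bdd_lipM; first exact: bdd_lip_cst.
  apply: bdd_lipM; first exact: bdd_lip_cst.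
  by apply: bdd_lip_sum => // a _; exact: (bdd_lipM (bV a) (brhs a)).
have bga a : bdd_lip close (fun s => bad_ga j l (Ps s) (Hs s) (X s) (W s) (V s) a).
  apply: bdd_lipN => //; apply: bdd_lipD.
    apply: bdd_lipD; last exact: (bdd_lipM (bX l) (bbe a)).
    apply: bdd_lipD.
      by apply: bdd_lip_sum => // i _; exact: (bdd_lipM (bW i) (bP i a)).
    apply: bdd_lipM; first exact: bdd_lip_cst.
    by apply: bdd_lip_sum => // i _; exact: (bdd_lipM (bW i) (bal i)).
  apply: bdd_lipM; first exact: bdd_lip_cst.
  by apply: bdd_lip_sum => // b _; exact: (bdd_lipM (bX b) (bbe b)).
pose T (s : S) (k : 'I_d + 'I_d + 'I_m) : R := match k with
  | inl (inl b) => bad_be l (Hs s) (W s) (V s) b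
  | inl (inr a) => bad_ga j l (Ps s) (Hs s) (X s) (W s) (V s) a
  | inr i => bad_al (Ps s) (V s) i end.
have [C hC] : exists C : R, forall s s' r, close r s s' ->
    forall k, k \in B -> `|T s k - T s' k| <= C * r.
  by apply: bdd_lip_uniform => // -[[b|a]|i] _; [exact: bbe|exact: bga|exact: bal].
have AB : (#|A| < #|B|)%N.
  have := cardsC ([set inl (inr j); inr l]%SET : {set 'I_d + 'I_m + 'I_d}).
  have := cardsC ([set inr j]%SET : {set 'I_d + 'I_d + 'I_m}).
  rewrite -/A -/B cards1 cards2 !card_sum !card_ord /=; lia.
have piM s k : k \in A -> `|pi s k| <= M.
  by case: k => [[a|i]|a] _; apply: (le_trans (rV_norm_coord _ _)).
have [p [pn [eta eta0 heta]]] := lipschitz_image_avoid AB piM hC n0.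
exists (fun i => p (inr i)), (fun b => p (inl (inl b))), (fun a => p (inl (inr a))).
split => //.
pose K := 1 + m%:R * M + (1 + M + d%:R * M) * (1 + d%:R * M).
have K0 : 0 < K.
  have t1 : 0 <= m%:R * M by rewrite mulr_ge0.
  have t2 : 0 <= d%:R * M by rewrite mulr_ge0.
  have t3 : 0 <= (1 + M + d%:R * M) * (1 + d%:R * M) by rewrite mulr_ge0// !addr_ge0.
  by rewrite /K; lra.
(* A triple degenerate at this level would have all its bad parameters within [eta] of [p], against
   the choice of [p]. *)
exists (eta / K); first by rewrite divr_gt0.
move=> x w v xM wM wj vM vl deg.
have c0 : 0 <= eta / K by rewrite divr_ge0// ltW.
have [h1 h2 h3] := degenerate_bad_params M0 c0 xM wM wj vM vl deg.
have Kc : K * (eta / K) = eta by rewrite mulrC divfK// gt_eqF.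
have sP : [/\ `|(x, w, v).1.1| <= M, `|(x, w, v).1.2| <= M,
  (x, w, v).1.2 0 j = 1, `|(x, w, v).2| <= M & (x, w, v).2 0 l = 1] by [].
pose s : S := exist _ (x, w, v) sP.
have [k kB] := heta s; rewrite ltNge => /negP; apply; rewrite -Kc.
case: k kB => [[b|a]|i] kB; [exact: h2|exact: h3|apply: h1].
by move: kB; rewrite !inE; apply: contra => /eqP ->.
Qed.

(** The denominator of [r] adds up how much the three groups of expressions in [degenerate] can
    change per unit of C^2 distance, plus 1 for positivity. They then change by at most [c / 2]. *)
Lemma regular_on_perturb (f g : C2 R d m) (M : R) c :
  0 <= M -> 0 < c ->
  (forall (x : 'rV[R]_d) (w : 'rV[R]_m) (v : 'rV[R]_d),
    `|x| <= M -> `|w| <= M -> w 0 j = 1 -> `|v| <= M -> v 0 l = 1 ->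
    ~ degenerate c (fun i a => D1 f i a x) (fun i a b => D2 f i a b x) w v) ->
  let r := c / (2 * (m%:R * M + d%:R * M + m%:R * (d%:R * (M * M)) + 1)) in
  (C2norm (g \- f)%R < r%:E)%E ->
  regular_on (D1 g) (D2 g) M j l.
Proof.
move=> M0 c0 freg r gf; exists (c / 2); first by rewrite divr_gt0.
move=> x w v xM wM wj vM vl [E0 E1 E2]; apply: (freg x w v) => //.
have [_ DE D2E] := is_C2B (C2_funP g) (C2_funP f).
have [_ h1 h2] := C2norm_entries gf x.
have {}h1 i a : `|D1 f i a x - D1 g i a x| <= r.
  by rewrite distrC; have := h1 i a; rewrite DE mx_subE.
have {}h2 i a b : `|D2 f i a b x - D2 g i a b x| <= r.
  by rewrite distrC; have := h2 i a b; rewrite D2E mx_subE.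
pose Q := m%:R * M + d%:R * M + m%:R * (d%:R * (M * M)) + 1.
have t1 : 0 <= m%:R * M by rewrite mulr_ge0.
have t2 : 0 <= d%:R * M by rewrite mulr_ge0.
have t3 : 0 <= m%:R * (d%:R * (M * M)) by rewrite !mulr_ge0.
have Q0 : 0 < Q by rewrite /Q; lra.
have r0 : 0 < r by rewrite divr_gt0// mulr_gt0.
have Qr : Q * r = c / 2 by rewrite /r -/Q; field; rewrite gt_eqF.
have bound (B : R) (X Y : R) : `|Y| <= c / 2 -> `|X - Y| <= B -> B <= Q * r -> `|X| <= c.
  move=> Yc XY; rewrite Qr => BQ; rewrite -(subrK Y X) (le_trans (ler_normD _ _))//.
  by rewrite (splitr c) lerD// (le_trans XY).
have wiM i : `|w 0 i| <= M by apply: le_trans wM; exact: rV_norm_coord.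
have vaM a : `|v 0 a| <= M by apply: le_trans vM; exact: rV_norm_coord.
split=> [a|i|b].
- apply: (bound (m%:R * (M * r)) _ _ (E0 a)).
    rewrite -sumrB; apply: ler_norm_sum_ord; first by rewrite mulr_ge0// ltW.
    by move=> i _; rewrite -mulrBr normrM ler_pM.
  by rewrite mulrA ler_wpM2r ?(ltW r0)//; rewrite /Q; lra.
- apply: (bound (d%:R * (r * M)) _ _ (E1 i)).
    rewrite -sumrB; apply: ler_norm_sum_ord; first by rewrite mulr_ge0// ltW.
    by move=> a _; rewrite -mulrBl normrM ler_pM.
  by rewrite [r * M]mulrC mulrA ler_wpM2r ?(ltW r0)//; rewrite /Q; lra.
apply: (bound (m%:R * (d%:R * (M * M * r))) _ _ (E2 b)).
  have Mr0 : 0 <= M * M * r by rewrite mulr_ge0 ?(ltW r0)// mulr_ge0.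
  rewrite -sumrB; apply: ler_norm_sum_ord; first by rewrite mulr_ge0.
  move=> i _; rewrite -sumrB; apply: ler_norm_sum_ord => //.
  by move=> a _; rewrite -mulrBr !normrM ler_pM ?mulr_ge0// ler_pM.
have -> : m%:R * (d%:R * (M * M * r)) = m%:R * (d%:R * (M * M)) * r by ring.
by rewrite ler_wpM2r ?(ltW r0)// /Q; lra.
Qed.

(** The Leibniz rule gives at most four products. Outside the ball of radius [M'] they vanish with
    [chi], so local control of [z] yields a global C^2 bound. *)
Lemma cutoff_product_bound (chi z : 'rV[R]_d -> R) g h gz hz (M' Cc e : R) :
  0 <= e -> 0 <= Cc ->
  (forall x, M' < `|x| -> [/\ chi x = 0, forall a, g a x = 0 & forall a b, h a b x = 0]) ->
  (forall x, `|x| <= M' -> [/\ `|chi x| <= Cc, forall a, `|g a x| <= Cc &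
     forall a b, `|h a b x| <= Cc]) ->
  (forall x, `|x| <= M' -> [/\ `|z x| <= e, forall a, `|gz a x| <= e &
     forall a b, `|hz a b x| <= e]) ->
  forall x, [/\ `|chi x * z x| <= 4 * (Cc * e),
    forall a : 'I_d, `|chi x * gz a x + z x * g a x| <= 4 * (Cc * e) &
    forall a b : 'I_d, `|(chi x * hz a b x + gz a x * g b x) +
       (z x * h a b x + g a x * gz b x)| <= 4 * (Cc * e)].
Proof.
move=> e0 C0 hout hin hz' x.
have Ce0 : 0 <= Cc * e by exact: mulr_ge0.
have [xM|xM] := leP `|x| M'; last first.
  have [c0 g0 h0] := hout x xM.
  by split=> [|a|a b]; rewrite ?c0 ?g0 ?h0 ?mul0r ?mulr0 ?addr0 ?normr0; lra.
have [c0 g0 h0] := hin x xM; have [z0 gz0 hz0] := hz' x xM.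
have pr (s t : R) : `|s| <= Cc -> `|t| <= e -> `|s * t| <= Cc * e.
  by move=> sC te; rewrite normrM ler_pM.
have p1 := pr _ _ c0 z0.
split=> [|a|a b]; first lra.
  have p2 := pr _ _ c0 (gz0 a); have p3 := pr _ _ (g0 a) z0.
  apply: (le_trans (ler_normD _ _)); rewrite [z x * _]mulrC; lra.
have p2 := pr _ _ c0 (hz0 a b); have p3 := pr _ _ (g0 b) (gz0 a).
have p4 := pr _ _ (h0 a b) z0; have p5 := pr _ _ (g0 a) (gz0 b).
apply: (le_trans (ler_normD _ _)).
have := ler_normD (chi x * hz a b x) (gz a x * g b x).
have := ler_normD (z x * h a b x) (g a x * gz b x).
rewrite [gz a x * _]mulrC [z x * _]mulrC; lra.
Qed.

Lemma addr_subrDK (r s t k : R) : k = s - r + t -> s + t = r + k.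
Proof. by move=> ->; rewrite addrA addrCA subrr addr0. Qed.

(** The arithmetic behind the choice of [e] in [regular_dense]. *)
Lemma scaled_lt (q c t : R) : 0 <= q -> 0 <= c -> 0 < t ->
  q * (4 * (c * (2 * (t / ((q + 1) * (4 * (c + 1)) * 2))))) < t.
Proof.
move=> q0 c0 t0; have q1 : 0 < q + 1 by lra.
have c1 : 0 < c + 1 by lra.
have -> : q * (4 * (c * (2 * (t / ((q + 1) * (4 * (c + 1)) * 2))))) =
    (q * (4 * c)) / ((q + 1) * (4 * (c + 1))) * t by field; rewrite !gt_eqF.
rewrite gtr_pMl// ltr_pdivrMr ?mulr_gt0// mul1r.
have -> : (q + 1) * (4 * (c + 1)) = q * (4 * c) + 4 * q + 4 * c + 4 by ring.
lra.
Qed.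

Lemma regular_dense (f : C2 R d m) (M eps : R) : 1 <= M -> 0 < eps ->
  exists g : C2 R d m, (C2norm (g \- f)%R < eps%:E)%E /\ regular_on (D1 g) (D2 g) M j l.
Proof.
move=> M1 eps0.
have [chi [gc [hc [M' [gchi chi1 chi0]]]]] := exists_cutoff d M.
have [Cc Cc0 hCc] := is_grad2_bounded_cball M' gchi.
pose Q : R := (m + m * d + m * d * d)%:R.
pose e := eps / ((Q + 1) * (4 * (Cc + 1)) * 2).
have Q0 : 0 <= Q by [].
have den0 : 0 < (Q + 1) * (4 * (Cc + 1)) by rewrite !mulr_gt0// ltr_wpDl.
have e0 : 0 < e by rewrite divr_gt0// mulr_gt0.
have gf i := is_grad2_entry i (C2_funP f).
have sm i := smoothing_step (Num.max M M') (leqnn d) (gf i) e0.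
pose u i := sval (cid (sm i)); pose smu i := svalP (cid (sm i)).
pose g1 i := sval (cid (smu i)); pose smg i := svalP (cid (smu i)).
pose h1 i := sval (cid (smg i)); pose smh i := svalP (cid (smg i)).
have gu i : is_grad2 (u i) (g1 i) (h1 i) by have [] := smh i.
have cu i x : `|x| <= M' -> [/\ `|u i x - f x 0 i| <= e,
    forall a, `|g1 i a x - D1 f i a x| <= e &
    forall a b, `|h1 i a b x - D2 f i a b x| <= e].
  by move=> xM; have [_ h _ _] := smh i; apply: h; rewrite le_max xM orbT.
have Lg i a : lip_in d (g1 i a) by have [_ _ h _] := smh i; exact: h.
have Lh i a b : lip_in d (h1 i a b) by have [_ _ _ h] := smh i; exact: h.
(* Otherwise the cutoff would be both 1 and 0 at the origin. *)
have M'0 : 0 <= M'.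
  rewrite leNgt; apply/negP => M'0.
  have z1 : `|0 : 'rV[R]_d| <= M by rewrite normr0 (le_trans ler01).
  have z2 : M' < `|0 : 'rV[R]_d| by rewrite normr0.
  have [c1 _ _] := chi1 _ z1; have [c0 _ _] := chi0 _ z2.
  by move: c1; rewrite c0 => /eqP; rewrite eq_sym oner_eq0.
have [n n0 hn] := quad_small j l M'0 e0.
have [al [be [ga [aln ben gan reg]]]] := exists_regular_params M1 n0
  (fun i a => (gu i).1.2 a) (fun i a b => ((gu i).2 a).2 b) Lg Lh.
pose q i := quad j l al be ga i.
(* The approximation is [f + chi * z]. Where [chi = 1] it equals the smoothed map plus the quadratic
   one, which is regular; far away it is still [f]. *)
pose z i x := u i x - f x 0 i + q i x.
pose gz i a x := g1 i a x - D1 f i a x + quad_grad j l al be ga i a x.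
pose hz i a b x := h1 i a b x - D2 f i a b x + quad_hess j l be i a b x.
have gzz i : is_grad2 (z i) (gz i) (hz i).
  exact: (is_grad2D (is_grad2B (gu i) (gf i)) (is_grad2_quad j l al be ga i)).
have zsmall i x : `|x| <= M' -> [/\ `|z i x| <= 2 * e, forall a, `|gz i a x| <= 2 * e &
    forall a b, `|hz i a b x| <= 2 * e].
  move=> xM; have [a1 a2 a3] := cu i x xM; have [b1 b2 b3] := hn al be ga aln ben gan i x xM.
  split=> [|a|a b]; rewrite mulr2n mulrDl mul1r (le_trans (ler_normD _ _))// lerD//.
have e20 : 0 <= 2 * e by rewrite mulr_ge0// ltW.
have gk i := is_grad2M gchi (gzz i).
have [k [kE kC kD kD2]] : exists k : 'rV[R]_d -> 'rV[R]_m, [/\ forall x i, k x 0 i = chi x * z i x,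
    is_C2 k, (forall x i a, Df k x i a = chi x * gz i a x + z i x * gc a x) &
    forall x i a b, D2f k x (mxvec_index i a) b =
      (chi x * hz i a b x + gz i a x * gc b x) + (z i x * hc a b x + gc a x * gz i b x)].
  have [i|k1 k2 k3] := @is_C2_of_entries R d m (fun x => \row_i (chi x * z i x))
    (fun i a x => chi x * gz i a x + z i x * gc a x)
    (fun i a b x => (chi x * hz i a b x + gz i a x * gc b x) + (z i x * hc a b x + gc a x * gz i b x)).
    by have := gk i; congr is_grad2; apply/funext => x; rewrite mxE.
  by exists (fun x => \row_i (chi x * z i x)); split=> // x i; rewrite mxE.
have ksmall : (C2norm k <= (Q * (4 * (Cc * (2 * e))))%:E)%E.
  apply: C2norm_le; first by rewrite (mulr_ge0 _ (mulr_ge0 Cc0 e20)).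
  move=> x; have b i := cutoff_product_bound e20 Cc0 chi0 hCc (zsmall i) x.
  split=> [i|i a|i a a'].
  - by rewrite kE; have [] := b i.
  - by rewrite kD; have [_ h _] := b i.
  - by rewrite kD2; have [_ _ h] := b i.
have [gC gD gD2] := is_C2D (C2_funP f) kC.
pose g := MkC2 gC.
exists g; split.
  have -> : (g \- f)%R = k by apply/funext => x /=; rewrite addrAC subrr add0r.
  apply: (le_lt_trans ksmall); rewrite lte_fin.
  exact: scaled_lt.
case: reg => c c0 hreg; exists c => // x w v xM wM wj vM vl.
have := hreg x w v xM wM wj vM vl; apply: contra_not.
have [x1 x2 x3] := chi1 x xM.
have E1 i a : g1 i a x + quad_grad j l al be ga i a x = D1 g i a x.
  have E : D1 g i a x = Df f x i a + Df k x i a by rewrite /D1 gD mx_addE.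
  have := kD x i a; rewrite x1 x2 mul1r mulr0 addr0 => kE'.
  exact: etrans (addr_subrDK kE') (esym E).
have E2 i a b : h1 i a b x + quad_hess j l be i a b x = D2 g i a b x.
  have E : D2 g i a b x = D2f f x (mxvec_index i a) b + D2f k x (mxvec_index i a) b.
    by rewrite /D2 gD2 mx_addE.
  have := kD2 x i a b; rewrite x1 !x2 x3 mul1r mulr0 mul0r mulr0 !addr0 => kE'.
  exact: etrans (addr_subrDK kE') (esym E).
have E1' : (fun i a => g1 i a x + quad_grad j l al be ga i a x) = (fun i a => D1 g i a x).
  by apply/funext => i; apply/funext => a; exact: E1.
have E2' : (fun i a b => h1 i a b x + quad_hess j l be i a b x) = (fun i a b => D2 g i a b x).
  by apply/funext => i; apply/funext => a; apply/funext => b; exact: E2.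
by rewrite E1' E2'.
Qed.

End Density.

(** * Generic maps *)

Section GenericMaps.
Variables (R : realType) (d m : nat).

Definition regular_maps (M : R) (j : 'I_m) (l : 'I_d) : set (C2 R d m) :=
  [set f : C2 R d m | regular_on (fun i a x => Df f x i a)
    (fun i a b x => D2f f x (mxvec_index i a) b) M j l].

Lemma open_regular_maps M j l : 0 <= M -> open (regular_maps M j l).
Proof.
move=> M0; rewrite openE => f [c c0 hc]; rewrite /interior nbhsE.
pose r : R := c / (2 * (m%:R * M + d%:R * M + m%:R * (d%:R * (M * M)) + 1)).
have r0 : 0 < r.
  have t1 : 0 <= m%:R * M by rewrite mulr_ge0.
  have t2 : 0 <= d%:R * M by rewrite mulr_ge0.
  have t3 : 0 <= m%:R * (d%:R * (M * M)) by rewrite !mulr_ge0.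
  by rewrite divr_gt0// mulr_gt0//; lra.
exists (C2ball (f, r)); first by split; [exact: open_C2ball|exact: C2ball_center].
by move=> g gf; apply: (regular_on_perturb M0 c0 hc gf).
Qed.

Lemma dense_regular_maps M j l : 1 <= M -> dense (regular_maps M j l).
Proof.
move=> M1 O [f Of] oO; have [r r0 rO] := open_C2_ball_sub oO Of.
have [g [gf greg]] := regular_dense j l f M1 r0.
by exists g; split; [exact: rO|exact: greg].
Qed.

(** A rank below [m] gives a nonzero row vector in the left kernel. Dividing it by an entry of
    largest modulus, whose index is [j], gives norm 1, so the pair obeys the bound [M]. *)
Lemma critical_kernel_pair (f : 'rV[R]_d -> 'rV[R]_m) x (M : R) :
  (0 < m)%N -> critical_set f x -> `|x| <= M -> 1 <= M ->
  exists j, ((fun z : 'rV[R]_(d + m) => lsubmx z) @`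
    kernel_pairs (fun i a x => Df f x i a) M j) x.
Proof.
move=> m0 xcrit xM M1.
have [w [w0 wDf]] : exists w : 'rV[R]_m, w != 0 /\ w *m Df f x = 0.
  apply: contrapT => H.
  have : row_free (Df f x).
    apply: inj_row_free => w wDf; apply/eqP; apply: contraT => w0.
    by exfalso; apply: H; exists w.
  rewrite /row_free => /eqP rk; move: xcrit; rewrite /critical_set/= rk.
  by case: (m) m0 => // m' _; rewrite ltnn.
have nw0 : mx_norm w != 0.
  by apply: contra w0 => /eqP nw; rewrite -normr_eq0; apply/eqP.
have [[i j] /= wj] := mx_norm_neq0 nw0; rewrite ord1 in wj.
have wj' : `|w| = `|w 0 j| by exact: wj.
have wj0 : w 0 j != 0 by rewrite -normr_eq0 -wj'; exact: nw0.
exists j; exists (row_mx x ((w 0 j)^-1 *: w)); last by rewrite row_mxKl.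
have nw : `|(w 0 j)^-1 *: w| = 1 by rewrite normrZ wj' -normrM mulVf// normr1.
split.
- apply/rV_norm_le; first exact: le_trans M1.
  move=> k; case: (splitP k) => [a ka|i' ki'].
    have -> : k = lshift m a by exact: val_inj.
    by rewrite row_mxEl; apply: le_trans xM; exact: rV_norm_coord.
  have -> : k = rshift d i' by exact: val_inj.
  by rewrite row_mxEr; apply: le_trans M1; rewrite -nw; exact: rV_norm_coord.
- by rewrite row_mxKr mxE mulVf.
move=> a; rewrite row_mxKl row_mxKr.
have -> : \sum_i0 ((w 0 j)^-1 *: w) 0 i0 * Df f x i0 a =
    (w 0 j)^-1 * (w *m Df f x) 0 a.
  by rewrite [in RHS]mxE mulr_sumr; apply: eq_bigr => k _; rewrite mxE mulrA.
by rewrite wDf mxE mulr0.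
Qed.

Lemma regular_hausdorff (f : C2 R d m) (M : R) (K : set 'rV[R]_d) :
  (0 < m)%N -> (m <= d)%N -> 1 <= M -> (forall x, K x -> `|x| <= M) ->
  (forall j l, regular_maps M j l f) ->
  (hausdorff d.-1 (critical_set f `&` K) < +oo)%E.
Proof.
move=> m0 md M1 KM freg; apply: small_cover_hausdorff.
apply: (@small_coverW R d m.-1); first by rewrite -!subn1 leq_sub2r.
apply: (@small_cover_sub R d _ _ (\big[setU/set0]_(j <- index_enum 'I_m)
  ((fun z : 'rV[R]_(d + m) => lsubmx z) @` kernel_pairs (fun i a x => Df f x i a) M j))).
  move=> x [xc Kx]; have [j hj] := critical_kernel_pair m0 xc (KM x Kx) M1.
  by rewrite -bigcup_seq; exists j => //=; rewrite mem_index_enum.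
apply: small_cover_bigU => j.
apply: (kernel_pairs_cover (H := fun i a b x => D2f f x (mxvec_index i a) b)) => //.
  by move=> i a; have [_ h] := is_grad2_entry i (C2_funP f); exact: h.
by move=> l; exact: freg.
Qed.

End GenericMaps.

Theorem theorem1p1 (R : realType) (d m : nat) (hm : (1 <= m)%N) (hmd : (m <= d)%N) :
  exists M : set (C2 R d m),
    Gdelta_dense M /\
    forall f : C2 R d m, M f ->
      forall K : set 'rV[R]_d, compact K ->
        (hausdorff d.-1 (critical_set f `&` K) < +oo)%E.
Proof.
(* The triples are enumerated by their codes, with the whole space at numbers that code nothing. The
   successor ensures a radius of at least 1. *)
pose F (n : nat) : set (C2 R d m) :=
  if unpickle n is Some (k, j, l) then regular_maps (k : nat).+1%:R (j : 'I_m) (l : 'I_d)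
  else setT.
exists (\bigcap_n F n); split.
  exists F => // n; rewrite /F; case: unpickle => [[[k j] l]|].
    split; first exact: open_regular_maps.
    by apply: dense_regular_maps; rewrite ler1n.
  by split; [exact: openT|move=> O O0 _; rewrite setIT].
move=> f Ff K cK.
have [B [_ hB]] := compact_bounded cK.
(* An integer radius of the enumerated form, strictly above the bound of [K]. *)
pose N := (Num.truncn (Num.max B 0 + 1)).+1.
apply: (@regular_hausdorff R d m f N%:R) => //.
- by rewrite ler1n.
- move=> x Kx; have BN : Num.max B 0 + 1 < N%:R by exact: truncnS_gt.
  apply: hB Kx; apply: le_lt_trans BN.
  have : B <= Num.max B 0 by rewrite le_max lexx.
  lra.
move=> j l; have := Ff (pickle (Num.truncn (Num.max B 0 + 1), j, l)) I.
by rewrite /F pickleK.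
Qed.
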